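(* Let $(X,\mu)$ be a non-atomic probability measure space and let $\mathcal{T}$ be a tree on $X$ with associated dyadic maximal operator $\mathcal{M}_{\mathcal{T}}$. Let $1<q<p$, and for $0<f\le\frac{p}{p-1}F$ and $k\in[0,1]$ define $$\Delta(f,F,k)=\sup\left\{\int_K(\mathcal{M}_{\mathcal{T}}\phi)^q\,d\mu\ :\ \phi\ge0,\ \int_X\phi\,d\mu=f,\ \|\phi\|_{p,\infty}=F,\ K\subseteq X\text{ measurable with }\mu(K)=k\right\}.$$ Then for $F=\frac{p-1}{p}$, every $0<f\le1$ and every $k\in[0,1]$, $$\Delta\left(f,\tfrac{p-1}{p},k\right)=\begin{cases}\dfrac{p}{p-q}\,k^{1-\frac{q}{p}}, & k\le f^{\frac{p}{p-1}},\\[2ex] \dfrac{q(p-1)}{(p-q)(q-1)}\,f^{\frac{p-q}{p-1}}-\dfrac{1}{q-1}\,k^{1-q}f^q, & f^{\frac{p}{p-1}}\le k\le1.\end{cases}$$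
   Context: Tree: a set $\mathcal{T}$ of measurable subsets of $X$ is called a tree if: (1) $X\in\mathcal{T}$ and $\mu(I)>0$ for every $I\in\mathcal{T}$; (2) to every $I\in\mathcal{T}$ there corresponds a finite or countable subset $C(I)\subseteq\mathcal{T}$ containing at least two elements, such that the elements of $C(I)$ are pairwise disjoint subsets of $I$ and $I=\bigcup C(I)$; (3) $\mathcal{T}=\bigcup_{m\ge0}\mathcal{T}_{(m)}$, where $\mathcal{T}_{(0)}=\{X\}$ and $\mathcal{T}_{(m+1)}=\bigcup_{I\in\mathcal{T}_{(m)}}C(I)$; (4) $\lim_{m\to\infty}\sup_{I\in\mathcal{T}_{(m)}}\mu(I)=0$. Dyadic maximal operator: for $\phi\in L^1(X,\mu)$, $\mathcal{M}_{\mathcal{T}}\phi(x)=\sup\left\{\frac{1}{\mu(I)}\int_I|\phi|\,d\mu : x\in I\in\mathcal{T}\right\}$. Weak-$L^p$ quasi-norm: for measurable $\phi\ge0$ on $X$, $\|\phi\|_{p,\infty}=\sup\{\lambda\,\mu(\{\phi\ge\lambda\})^{1/p}:\lambda>0\}$. *)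

(* Defs.v *)
From HB Require Import structures.
From mathcomp Require Import all_boot all_order all_algebra.
From mathcomp Require Import all_classical all_reals all_analysis.
Import Order.TTheory GRing.Theory Num.Theory numFieldNormedType.Exports.

Set Implicit Arguments.
Unset Strict Implicit.
Unset Printing Implicit Defensive.

Local Open Scope classical_set_scope.
Local Open Scope ring_scope.
Local Open Scope ereal_scope.

Definition nonatomic d (X : measurableType d) (R : realType)
    (mu : {measure set X -> \bar R}) : Prop :=
  forall A : set X, measurable A -> 0 < mu A ->
    exists B : set X, [/\ measurable B, B `<=` A, 0 < mu B & mu B < mu A].

Fixpoint tree_level (X : Type) (C : set X -> set (set X)) (m : nat) :
    set (set X) :=
  match m with
  | 0%N => [set [set: X]]
  | m'.+1 => \bigcup_(I in tree_level C m') C I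
  end.

(* The values of C outside TT are irrelevant. *)
Definition is_tree_with d (X : measurableType d) (R : realType)
    (mu : {measure set X -> \bar R}) (TT : set (set X))
    (C : set X -> set (set X)) : Prop :=
  [/\ (forall I, TT I -> measurable I),
      TT [set: X] /\ (forall I, TT I -> 0 < mu I),
      (forall I, TT I ->
        [/\ C I `<=` TT,
            countable (C I),
            (exists J1 J2, [/\ C I J1, C I J2 & J1 <> J2]),
            trivIset (C I) id &
            (forall J, C I J -> J `<=` I) /\ I = \bigcup_(J in C I) J]),
      TT = \bigcup_m tree_level C m &
      (fun m => ereal_sup [set mu I | I in tree_level C m]) @ \oo --> 0].

Definition is_tree d (X : measurableType d) (R : realType)
    (mu : {measure set X -> \bar R}) (TT : set (set X)) : Prop :=
  exists C : set X -> set (set X), is_tree_with mu TT C.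

Definition dyadic_maximal d (X : measurableType d) (R : realType)
    (mu : {measure set X -> \bar R}) (TT : set (set X)) (phi : X -> R)
    (x : X) : \bar R :=
  ereal_sup [set (mu I)^-1 * \int[mu]_(y in I) `|(phi y)%:E|
            | I in [set I | TT I /\ I x]].

Definition weak_Lnorm d (X : measurableType d) (R : realType)
    (mu : {measure set X -> \bar R}) (p : R) (phi : X -> R) : \bar R :=
  ereal_sup [set l%:E * mu [set x | (l <= phi x)%R] `^ p^-1
            | l in [set l : R | (0 < l)%R]].

(* Measurability, nonnegativity and the finite integral of phi put it in L^1. *)
Definition Delta d (X : measurableType d) (R : realType)
    (mu : {measure set X -> \bar R}) (TT : set (set X)) (p q f F k : R) :
    \bar R :=
  ereal_sup [set v | exists (phi : X -> R) (K : set X),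
    [/\ measurable_fun [set: X] phi /\ (forall x, (0 <= phi x)%R),
        \int[mu]_x (phi x)%:E = f%:E,
        weak_Lnorm mu p phi = F%:E,
        measurable K /\ mu K = k%:E &
        v = \int[mu]_(x in K) (dyadic_maximal mu TT phi x `^ q)]].

(* Main.v *)
(* Let tau = f^(p/(p-1)).  The weak type inequality l mu{M phi > l} <=
   int_{M phi > l} phi, together with int_E phi <= min(f, mu(E)^(1-1/p)), gives
   mu(K, M phi > l) <= min(k, f/l, l^(-p)), and integrating these tails yields the
   upper bound.  Equality would need M phi to be distributed like
   min(t^(-1/p), f/t), the running average of phi* = (p-1)/p t^(-1/p) 1_{t <= tau}.
   To approach it for r < 1 close to 1, build A_0 = X, A_1, A_2, ..., each A_n a
   disjoint union of tree members I with mu(I, A_(n+m)) = r^m mu(I), and a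
   variable V, uniform on [0,1], for which A_n = {V <= r^n} up to a null set.  For
   phi = (p-1)/p V^(-1/p) 1_{V <= tau} (for f = 1 the distribution of phi is
   forced, so step functions would not do), homogeneity bounds the average of phi
   over I below by r times its average over {V <= r^n}, so that
   M phi >= r^2 min(V^(-1/p), f/V) almost everywhere; take K = {V <= k}. *)
Require Import Defs.
From HB Require Import structures.
From mathcomp Require Import all_boot all_order all_algebra.
From mathcomp Require Import all_classical all_reals all_analysis.
From mathcomp Require Import measurable_realfun.
From mathcomp Require Import ring lra.
Import Order.TTheory GRing.Theory Num.Theory numFieldNormedType.Exports.
Local Open Scope classical_set_scope.
Local Open Scope ring_scope.

Set Implicit Arguments.
Unset Strict Implicit.
Unset Printing Implicit Defensive.

(** * Trees *)

(** Both bounds meet in one integral, that of min(k, f l^(-1/q), l^(-p/q)) over l > 0. The two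
    formulas are its evaluations for k below and above the common value tau of f x and x^p at their
    crossing. The normalisation F = (p-1)/p is what gives int_E phi <= mu(E)^(1-1/p) the constant 1.
    The difficulty lies in V: the space is abstract, and only the tree can locate its points. A
    numerical code orders them first by the sets A_n and then by tree membership; the shrinking of
    the tree levels keeps the code free of atoms, and composing it with its distribution function
    makes it uniform. The law of such a V inside a single member I of the n-th family is not
    prescribed: what is known is how much of I lies in each A_(n+m). Averages of phi over I are
    therefore compared with averages over {V <= r^n} one height at a time, after rounding each
    threshold for V down to a power of r. This rounding costs one factor r. Passing from r^n to V x,
    where r^(n+1) <= V x, costs the other. *)

Section tree_structure.
Context d (X : measurableType d) (R : realType) (mu : probability X R).
Context (TT : set (set X)) (C : set X -> set (set X)).
Context (treeC : is_tree_with mu TT C).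

Lemma tree_level_sub m I : tree_level C m I -> TT I.
Proof. by case: treeC => _ _ _ -> _ ?; exists m. Qed.

Lemma tree_in_level I : TT I -> exists m, tree_level C m I.
Proof. by case: treeC => _ _ _ -> _ [m _ ?]; exists m. Qed.

Lemma tree_measurable I : TT I -> measurable I.
Proof. by case: treeC => + _ _ _ _; exact. Qed.

Lemma tree_gt0 I : TT I -> (0 < mu I)%E.
Proof. by case: treeC => _ [_ +] _ _ _; exact. Qed.

Lemma tree_level_trivIset m : trivIset (tree_level C m) id.
Proof.
elim: m => [|m IH]; first by move=> I J /= -> ->.
move=> I J [I' LI' CI] [J' LJ' CJ] [x [Ix Jx]].
have [_ _ childI _ _] := treeC.
have [_ _ _ tI [subI _]] := childI _ (tree_level_sub LI').
have [_ _ _ _ [subJ _]] := childI _ (tree_level_sub LJ').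
have IJ : I' = J'.
  apply: IH => //; exists x; split; [exact: subI Ix|exact: subJ Jx].
by subst J'; apply: tI => //; exists x.
Qed.

Lemma tree_level_cover m : \bigcup_(I in tree_level C m) I = setT.
Proof.
elim: m => [|m IH]; first by rewrite bigcup_set1.
apply/seteqP; split => // x _.
have [I LI Ix] : (\bigcup_(I in tree_level C m) I) x by rewrite IH.
have [_ _ childI _ _] := treeC.
have [_ _ _ _ [_ IE]] := childI _ (tree_level_sub LI).
by move: Ix; rewrite IE => -[J CJ Jx]; exists J => //; exists I.
Qed.

Lemma tree_level_ancestor m n J : (m <= n)%N -> tree_level C n J ->
  exists2 I, tree_level C m I & J `<=` I.
Proof.
elim: n J => [|n IH] J; first by rewrite leqn0 => /eqP -> LJ; exists J.
rewrite leq_eqVlt => /predU1P[->|]; first by exists J.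
rewrite ltnS => mn [J' LJ' CJ].
have [I LI J'I] := IH _ mn LJ'; exists I => //.
have [_ _ childI _ _] := treeC.
have [_ _ _ _ [subJ _]] := childI _ (tree_level_sub LJ').
exact: subset_trans (subJ _ CJ) J'I.
Qed.

Lemma tree_level_nested m n I J : (m <= n)%N ->
  tree_level C m I -> tree_level C n J -> I `&` J !=set0 -> J `<=` I.
Proof.
move=> mn LI /(tree_level_ancestor mn)[I' LI' JI'] [x [Ix Jx]].
suff -> : I = I' by [].
by apply: (@tree_level_trivIset m) => //; exists x; split => //; exact: JI'.
Qed.

Lemma tree_countable : countable TT.
Proof.
have [_ _ childI TE _] := treeC.
rewrite TE; apply: bigcup_countable => // m _.
elim: m => [|m IH]; first exact: countable1.
apply: bigcup_countable => // I LI.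
by have [] := childI _ (tree_level_sub LI).
Qed.

Lemma tree_level_small (e : R) : 0 < e ->
  exists m, forall n I, (m <= n)%N -> tree_level C n I -> (mu I < e%:E)%E.
Proof.
move=> e0; have [_ _ _ _ sup0] := treeC.
have [|m _ mP] := sup0 [set u | u < e%:E]%E.
  by apply: open_ereal_lt'; rewrite lte_fin.
exists m => n I /mP /= supe LI; apply: le_lt_trans supe.
by apply: ereal_sup_ubound; exists I.
Qed.

(** The members of [S] that are maximal under inclusion do it. A member that is not maximal lies
    inside another one of strictly smaller level, so the search for a maximal member above a given
    point ends by induction on the level. *)
Lemma tree_disjoint_subfamily (S : set (set X)) : S `<=` TT ->
  exists S', [/\ S' `<=` S, trivIset S' id &
    \bigcup_(I in S') I = \bigcup_(I in S) I].
Proof.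
move=> ST; pose maximal I := S I /\ forall J, S J -> I `<=` J -> J `<=` I.
exists maximal; split; first by move=> ? [].
- move=> I J [SI mI] [SJ mJ] IJ.
  have [m LI] := tree_in_level (ST _ SI); have [n LJ] := tree_in_level (ST _ SJ).
  have [mn|/ltnW mn] := leqP m n.
    have JI := tree_level_nested mn LI LJ IJ.
    by apply/seteqP; split => //; exact: mJ.
  have {}JI : I `<=` J by apply: (tree_level_nested mn LJ LI); rewrite setIC.
  by apply/seteqP; split => //; exact: mI.
- apply/seteqP; split => x [J SJ Jx]; first by exists J => //; case: SJ.
  have [n LJ] := tree_in_level (ST _ SJ).
  elim/ltn_ind: n => n IH in J SJ Jx LJ *.
  have [mJ|] := pselect (forall J', S J' -> J `<=` J' -> J' `<=` J).
    by exists J.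
  move=> /existsNP[J' /not_implyP[SJ' /not_implyP[JJ' J'J]]].
  have [n' LJ'] := tree_in_level (ST _ SJ').
  have [nn'|n'n] := leqP n n'; last by apply: (IH n' n'n J') => //; exact: JJ'.
  exfalso; apply: J'J; apply: (tree_level_nested nn' LJ LJ').
  by exists x; split => //; exact: JJ'.
Qed.

End tree_structure.

(** Gives access to countable additivity along [nat]. A set is placed at its code under an injection
    into [nat], and the indices that are no code receive the empty set; each union in the witness
    thus involves at most one set. *)
Lemma disjoint_family_sequence T (S : set (set T)) :
  countable S -> trivIset S id -> exists e : nat -> set T,
  [/\ trivIset setT e, \bigcup_i e i = \bigcup_(I in S) I &
      forall i, S (e i) \/ e i = set0].
Proof.
move=> /countable_injP[g ginj] tS.
have gI I J : S I -> S J -> g I = g J -> I = J.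
  by move=> SI SJ; apply: ginj; rewrite inE.
exists (fun i => \bigcup_(I in [set I | S I /\ g I = i]) I); split.
- move=> i j _ _ [x [[I [SI <-] Ix] [J [SJ <-] Jx]]].
  by rewrite (tS I J)//; exists x.
- apply/seteqP; split => x; first by move=> [i _ [I [SI _] Ix]]; exists I.
  by move=> [I SI Ix]; exists (g I) => //; exists I.
- move=> i; have [[I [SI gi]]|nI] := pselect (exists I, S I /\ g I = i).
    left; rewrite (_ : \bigcup_(_ in _) _ = I)//; apply/seteqP; split => x.
      by move=> [J [SJ gj] Jx]; rewrite (gI I J)// gi gj.
    by move=> Ix; exists I.
  right; apply/seteqP; split => x// [I [SI gi] _].
  by apply: nI; exists I.
Qed.

Lemma measurable_bigcup_family d (X : measurableType d) (S : set (set X)) :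
  countable S -> (forall I, S I -> measurable I) ->
  measurable (\bigcup_(I in S) I).
Proof.
move=> cS mS; rewrite bigcup_set_type; apply: countable_bigcupT_measurable.
  by rewrite (eq_countable (card_setT _)).
by move=> I; exact/mS/set_valP.
Qed.

Section disjoint_families.
Context d (X : measurableType d) (R : realType).
Context (mu : {measure set X -> \bar R}) (S : set (set X)).
Context (mS : forall I, S I -> measurable I) (cS : countable S).
Context (tS : trivIset S id).

Lemma measure_bigcup_scale (E : set X) (c : R) : measurable E -> 0 <= c ->
  (forall I, S I -> mu (I `&` E) = c%:E * mu I)%E ->
  (mu ((\bigcup_(I in S) I) `&` E) = c%:E * mu (\bigcup_(I in S) I))%E.
Proof.
move=> mE c0 SE; have [e [te <- Se]] := disjoint_family_sequence cS tS.
have me i : measurable (e i) by case: (Se i) => [/mS//|->].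
rewrite setI_bigcupl !measure_bigcup//; last 2 first.
- by move=> i _; exact: measurableI.
- exact: trivIset_setIr.
rewrite -nneseriesZl//; apply: eq_eseriesr => i _.
by case: (Se i) => [/SE//|->]; rewrite set0I measure0 mule0.
Qed.

Lemma le_mul_integral_bigcup (phi : X -> \bar R) (l : R) :
  measurable_fun setT phi -> (forall x, 0 <= phi x)%E -> 0 <= l ->
  (forall I, S I -> l%:E * mu I <= \int[mu]_(x in I) phi x)%E ->
  (l%:E * mu (\bigcup_(I in S) I) <= \int[mu]_(x in \bigcup_(I in S) I) phi x)%E.
Proof.
move=> mphi phi0 l0 SE; have [e [te <- Se]] := disjoint_family_sequence cS tS.
have me i : measurable (e i) by case: (Se i) => [/mS//|->].
rewrite measure_bigcup// ge0_integral_bigcup//; last exact: measurable_funTS.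
rewrite [X in (_ * X)%E](_ : _ = \sum_(i <oo) mu (e i))%E; last first.
  by apply: eq_eseriesl => i; rewrite in_setT.
rewrite -nneseriesZl//; apply: lee_nneseries => i *; first by rewrite mule_ge0.
by case: (Se i) => [/SE//|->]; rewrite measure0 mule0 integral_set0.
Qed.

End disjoint_families.

(** * Subfamilies of the tree that fill a prescribed proportion of their parent *)

Section tree_selection.
Context d (X : measurableType d) (R : realType) (mu : probability X R).
Context (TT : set (set X)) (C : set X -> set (set X)).
Context (treeC : is_tree_with mu TT C).

Lemma tree_enumeration : exists e : nat -> set X,
  (forall n, TT (e n)) /\ (forall I, TT I -> exists n, e n = I).
Proof.
have [g ginj] := countable_injP _ (tree_countable treeC).
have TX : TT setT by case: treeC => _ [].
exists (fun n => xget setT [set I | TT I /\ g I = n]); split.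
  by move=> n; case: xgetP => [I _ []|].
move=> I TI; exists (g I); case: xgetP => [J _ [TJ gJ]|/(_ I)[]//].
by apply: ginj; rewrite ?inE.
Qed.

(* Greedy choice: run through the tree and keep every member inside I that does
   not push the measure of the union above the target. Since deep levels have
   small members, a union of smaller measure would swallow all of I. *)
Lemma tree_select (I : set X) (a : R) : TT I -> 0 <= a <= 1 ->
  exists S, [/\ S `<=` TT, trivIset S id, forall J, S J -> J `<=` I &
    (mu (\bigcup_(J in S) J) = a%:E * mu I)%E].
Proof.
move=> TI /andP[a0 a1]; have [e [Te eT]] := tree_enumeration.
have me n : measurable (e n) by exact: (tree_measurable treeC (Te n)).
set c := (a%:E * mu I)%E.
pose acc B n := `[< e n `<=` I /\ (mu (B `|` e n) <= c)%E >].
pose B := fix B n := if n is m.+1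
  then B m `|` (if acc (B m) m then e m else set0) else set0.
have c0 : (0 <= c)%E by rewrite mule_ge0.
have mI := tree_measurable treeC TI.
have cfin : c \is a fin_num by rewrite fin_numM// fin_num_measure.
have mB n : measurable (B n).
  by elim: n => //= n IH; apply: measurableU => //; case: ifP.
have ndB : nondecreasing_seq B.
  by apply/nondecreasing_seqP => n; apply/subsetPset => x /=; left.
have Bc n : (mu (B n) <= c)%E.
  elim: n => [|n IH] /=; first by rewrite measure0.
  by case: ifPn => [/asboolP[]//|_]; rewrite setU0.
pose U := \bigcup_n B n.
have mU : measurable U by exact: bigcup_measurable.
have Uc : (mu U <= c)%E.
  have cv : mu \o B @ \oo --> mu U by exact: nondecreasing_cvg_mu.
  rewrite -(cvg_lim _ cv)//; apply: lime_le; first by apply/cvg_ex; exists (mu U).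
  exact: nearW.
pose S0 := [set e n | n in [set n | acc (B n) n]].
have S0U : \bigcup_(J in S0) J = U.
  apply/seteqP; split => x.
    move=> [_ [n accn <-] enx]; exists n.+1 => //=; right.
    by move: accn => /= ->.
  move=> [n _]; elim: n => //= n IH [|]; first exact: IH.
  by case: ifPn => // accn enx; exists (e n) => //; exists n.
have S0T : S0 `<=` TT by move=> _ [n _ <-].
(* The accepted sets may be nested, since a small member can be accepted before a larger one that
   contains it; the maximal ones have the same union and are disjoint. *)
have [S [SS0 tS SU]] := tree_disjoint_subfamily treeC S0T.
exists S; split => //.
- exact: (subset_trans SS0 S0T).
- by move=> J /SS0[n /asboolP[]] + _ <-.
rewrite SU S0U; apply/eqP; rewrite eq_le Uc/= leNgt; apply/negP => Ultc.
have Ufin : mu U \is a fin_num by exact: fin_num_measure.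
pose eps := fine c - fine (mu U).
have eps0 : 0 < eps by rewrite subr_gt0 -lte_fin !fineK.
have epsE : c = (mu U + eps%:E)%E by rewrite EFinB !fineK// addeCA subee// adde0.
have [m small] := tree_level_small treeC eps0.
have [m0 LI] := tree_in_level treeC TI.
have IU : I `<=` U.
  move=> x Ix; have : setT x by [].
  (* The level has to be at least [m], so that its members are smaller than the deficit [eps], and
     at least the level [m0] of [I], so that a member meeting [I] lies inside it. Such a member
     passes the test whenever its turn comes. *)
  rewrite -(tree_level_cover treeC (maxn m m0)) => -[J LJ Jx].
  have JI : J `<=` I.
    by apply: (tree_level_nested treeC (leq_maxr m m0) LI LJ); exists x.
  have [n en] := eT _ (tree_level_sub treeC LJ).
  exists n.+1 => //=; right; rewrite ifT ?en//; apply/asboolP; rewrite en.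
  split => //; rewrite epsE.
  have mJ : measurable J by exact: (tree_measurable treeC (tree_level_sub treeC LJ)).
  apply: (le_trans (measureU2 _ (mB n) mJ)).
  apply: leeD; first by apply: le_measure; rewrite ?inE//; exact: bigcup_sup.
  by apply/ltW/(small (maxn m m0)) => //; exact: leq_maxl.
suff : (c <= mu U)%E by rewrite leNgt Ultc.
apply: (@le_trans _ _ (mu I)); first by rewrite gee_pMl// fin_num_measure.
by apply: le_measure; rewrite ?inE.
Qed.

(** The selection is repeated with proportion [r] inside every member already selected. The
    proportions must be exact within each single [I], not merely in total, because the maximal
    operator will be tested on a single [I]. *)
Lemma tree_hierarchy (r : R) : 0 <= r <= 1 ->
  exists FF : nat -> set (set X), [/\ FF 0%N = [set setT],
    forall n, FF n `<=` TT, forall n, trivIset (FF n) id,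
    forall n, \bigcup_(I in FF n.+1) I `<=` \bigcup_(I in FF n) I &
    forall n m I, FF n I ->
      (mu (I `&` \bigcup_(J in FF (n + m)%N) J) = (r ^+ m)%:E * mu I)%E].
Proof.
move=> r01.
have /choice[sel selP] I : exists S, TT I ->
    [/\ S `<=` TT, trivIset S id, forall J, S J -> J `<=` I &
    (mu (\bigcup_(J in S) J) = r%:E * mu I)%E].
  have [TI|nTI] := pselect (TT I); last by exists set0.
  by have [S ?] := tree_select TI r01; exists S.
pose FF := fix FF n := if n is m.+1 then \bigcup_(I in FF m) sel I else [set setT].
have FT n : FF n `<=` TT.
  elim: n => [I ->|n IH J [I FI]] /=; first by case: treeC => _ [].
  by have [+ _ _ _] := selP _ (IH _ FI); exact.
have tF n : trivIset (FF n) id.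
  elim: n => [|n IH]; first by move=> I J /= -> ->.
  move=> J J' [I FI sJ] [I' FI' sJ'] [x [Jx J'x]].
  have [_ tI sI _] := selP _ (FT _ _ FI).
  have [_ _ sI' _] := selP _ (FT _ _ FI').
  have II' : I = I'.
    by apply: (IH I I') => //; exists x; split; [exact: (sI _ sJ)|exact: (sI' _ sJ')].
  by subst I'; apply: tI => //; exists x.
have decF n : \bigcup_(I in FF n.+1) I `<=` \bigcup_(I in FF n) I.
  move=> x [J [I FI sJ] Jx]; exists I => //.
  by have [_ _ + _] := selP _ (FT _ _ FI); apply; [exact: sJ|].
have FSsub n m : \bigcup_(I in FF (n + m)%N) I `<=` \bigcup_(I in FF n) I.
  elim: m => [|m IH]; rewrite ?addn0// addnS.
  exact: (subset_trans (decF _) IH).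
have mF n : measurable (\bigcup_(I in FF n) I).
  apply: measurable_bigcup_family => [|I /FT]; last exact: (tree_measurable treeC).
  exact: (sub_countable (subset_card_le (FT n)) (tree_countable treeC)).
exists FF; split => // n m; elim: m n => [|m IH] n I FI.
  rewrite addn0 expr0 mul1e; congr (mu _); apply/setIidPl => x Ix.
  by exists I.
have [sT tI sI muI] := selP _ (FT _ _ FI).
(* By disjointness of [FF n], the members of [FF n.+1] that meet [I] are exactly those selected
   inside [I]; the induction hypothesis then applies to each of them. *)
have -> : I `&` \bigcup_(J in FF (n + m.+1)%N) J =
    \bigcup_(J in sel I) J `&` \bigcup_(J in FF (n.+1 + m)%N) J.
  rewrite addnS -addSn; apply/seteqP; split => x [Ix Ux]; split => //.
    have [J [I' FI' sJ] Jx] := FSsub n.+1 m _ Ux.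
    suff -> : I = I' by exists J.
    apply: (tF n) => //; exists x; split => //.
    by have [_ _ + _] := selP _ (FT _ _ FI'); apply; [exact: sJ|].
  by case: Ix => J sJ Jx; exact: (sI _ sJ).
have msel J : sel I J -> measurable J.
  by move=> /sT; exact: (tree_measurable treeC).
have csel := sub_countable (subset_card_le sT) (tree_countable treeC).
have r0 : 0 <= r ^+ m by rewrite exprn_ge0//; case/andP: r01.
rewrite (measure_bigcup_scale msel csel tI (mF _) r0).
  by rewrite [X in (_ * X)%E]muI exprSr EFinM muleA.
by move=> J sJ; apply: IH => /=; exists I.
Qed.

End tree_selection.

(** * The maximal function *)

Lemma lee_mean d (X : measurableType d) (R : realType) (mu : probability X R)
    (I : set X) (c : R) (y : \bar R) : measurable I -> (0 < mu I)%E ->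
  (c%:E <= (mu I)^-1 * y)%E = (c%:E * mu I <= y)%E.
Proof.
move=> mI I0; have If : mu I \is a fin_num by exact: fin_num_measure.
rewrite -(fineK If) in I0 *; rewrite lte_fin in I0.
by rewrite inver gt_eqF// muleC lee_pdivlMr.
Qed.

Section maximal_function.
Context d (X : measurableType d) (R : realType) (mu : probability X R).
Context (TT : set (set X)) (C : set X -> set (set X)).
Context (treeC : is_tree_with mu TT C).
Context (phi : X -> R) (mphi : measurable_fun setT phi).
Context (phi0 : forall x, 0 <= phi x).
Local Notation M := (dyadic_maximal mu TT phi).

Lemma dyadic_maximal_ge (I : set X) x (c : R) : TT I -> I x ->
  (c%:E * mu I <= \int[mu]_(y in I) (phi y)%:E)%E -> (c%:E <= M x)%E.
Proof.
move=> TI Ix cI; have mI := tree_measurable treeC TI.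
have I0 := tree_gt0 treeC TI.
apply: (@le_trans _ _ ((mu I)^-1 * \int[mu]_(y in I) `|(phi y)%:E|)%E); last first.
  by apply: ereal_sup_ubound; exists I.
under eq_integral do rewrite gee0_abs ?lee_fin//.
by rewrite lee_mean.
Qed.

Lemma dyadic_maximal_ge0 x : (0 <= M x)%E.
Proof.
have TX : TT setT by case: treeC => _ [].
apply: (dyadic_maximal_ge TX) => //.
by rewrite mul0e; apply: integral_ge0 => y _; rewrite lee_fin.
Qed.

Definition big_mean (l : R) :=
  [set I | TT I /\ (l%:E < (mu I)^-1 * \int[mu]_(y in I) `|(phi y)%:E|)%E].

Lemma dyadic_maximal_gt (l : R) :
  [set x | (l%:E < M x)%E] = \bigcup_(I in big_mean l) I.
Proof.
apply/seteqP; split => x /=.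
  by move=> /ereal_sup_gt[_ [I [TI Ix] <-] lI]; exists I.
move=> [I [TI lI] Ix]; apply: (lt_le_trans lI).
by apply: ereal_sup_ubound; exists I.
Qed.

Let big_mean_sub l : big_mean l `<=` TT. Proof. by move=> I []. Qed.

Let big_mean_countable l : countable (big_mean l).
Proof.
exact: (sub_countable (subset_card_le (@big_mean_sub l)) (tree_countable treeC)).
Qed.

Lemma measurable_dyadic_maximal_gt (l : R) : measurable [set x | (l%:E < M x)%E].
Proof.
rewrite dyadic_maximal_gt; apply: measurable_bigcup_family => // I /big_mean_sub.
exact: (tree_measurable treeC).
Qed.

Lemma measurable_dyadic_maximal : measurable_fun setT M.
Proof.
apply: (measurability _ (ErealGenOInfty.measurableE R)).
move=> _ [_ [l ->] <-]; rewrite setTI.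
suff -> : M @^-1` `]l%:E, +oo[%classic = [set x | (l%:E < M x)%E].
  exact: measurable_dyadic_maximal_gt.
by apply/seteqP; split => x /=; rewrite in_itv/= andbT.
Qed.

(** The level set is the union of the members with mean above [l]. Its maximal members are disjoint,
    and the inequality holds on each, so it can be summed. Keeping the integral over the level set
    only, rather than over the whole space, is what lets the weak norm enter later. *)
Lemma dyadic_maximal_weak11 (l : R) : 0 <= l ->
  (l%:E * mu [set x | (l%:E < M x)%E] <=
   \int[mu]_(x in [set x | (l%:E < M x)%E]) (phi x)%:E)%E.
Proof.
move=> l0; rewrite dyadic_maximal_gt.
have [S [SB tS SU]] := tree_disjoint_subfamily treeC (@big_mean_sub l).
have mS I : S I -> measurable I.
  by move=> /SB/big_mean_sub; exact: (tree_measurable treeC).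
have cS := sub_countable (subset_card_le SB) (big_mean_countable l).
rewrite -SU; apply: (le_mul_integral_bigcup mS cS tS (phi := EFin \o phi)) => //.
  exact/measurable_EFinP.
move=> I SI; have [TI lI] := SB _ SI.
rewrite -lee_mean; [|exact: mS|exact: (tree_gt0 treeC TI)].
rewrite (le_trans (ltW lI))// [leRHS](_ : _ =
  (mu I)^-1 * \int[mu]_(y in I) `|(phi y)%:E|)%E//; congr (_ * _)%E.
by apply: eq_integral => y _; rewrite gee0_abs ?lee_fin.
Qed.

End maximal_function.

(** * Layer cake and power integrals *)

Section layer_cake.
Context d (X : measurableType d) (R : realType) (mu : probability X R).
Local Notation leb := (@lebesgue_measure R).

Lemma lebesgue_measure_below (y : \bar R) : (0 <= y)%E ->
  leb [set l : R | 0 < l /\ (l%:E < y)%E] = y.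
Proof.
case: y => [y| |] // y0.
- rewrite (_ : [set _ | _] = `]0, y[%classic).
    rewrite lebesgue_measure_itv/= lte_fin oppr0 addr0.
    by case: ltP => // ; rewrite lee_fin in y0 => ?; congr EFin; apply/le_anti/andP.
  by apply/seteqP; split => l /=; rewrite in_itv/= lte_fin => /andP.
- rewrite (_ : [set _ | _] = `]0, +oo[%classic).
    by rewrite lebesgue_measure_itv/= ltry.
  by apply/seteqP; split => l /=; rewrite in_itv/= ?andbT ?ltry// => -[].
Qed.

Lemma measurable_gt (h : X -> \bar R) (y : \bar R) :
  measurable_fun setT h -> measurable [set x | (y < h x)%E].
Proof.
by move=> mh; rewrite -[X in measurable X]setTI; exact: emeasurable_fun_o_infty.
Qed.

Lemma measurable_tail (K : set X) (h : X -> \bar R) :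
  measurable K -> measurable_fun setT h ->
  measurable_fun setT (fun l : R => mu (K `&` [set x | (l%:E < h x)%E])).
Proof.
move=> mK mh; have mA l : measurable (K `&` [set x | (l%:E < h x)%E]).
  by apply: measurableI => //; exact: measurable_gt.
rewrite (_ : (fun _ => _) =
    EFin \o (fun l : R => fine (mu (K `&` [set x | (l%:E < h x)%E])))).
  apply/measurable_EFinP; apply: nonincreasing_measurable => // l l' ll'.
  rewrite fine_le ?fin_num_measure//; apply: le_measure; rewrite ?inE//.
  move=> x [Kx /= l'x]; split => //; apply: le_lt_trans l'x.
  by rewrite lee_fin.
by apply/funext => l /=; rewrite fineK// fin_num_measure.
Qed.

Lemma layer_cake (K : set X) (h : X -> \bar R) :
  measurable K -> measurable_fun setT h -> (forall x, 0 <= h x)%E ->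
  (\int[mu]_(x in K) h x =
   \int[leb]_(l in `]0%R, +oo[) mu (K `&` [set x | (l%:E < h x)%E]))%E.
Proof.
move=> mK mh h0.
pose A : set (X * R) := [set z | [/\ K z.1, 0 < z.2 & (z.2%:E < h z.1)%E]].
have mA : measurable A.
  rewrite (_ : A = fst @^-1` K `&` (snd @^-1` `]0, +oo[%classic `&`
      [set z : X * R | (z.2%:E < h z.1)%E])); last first.
    apply/seteqP; split => z /=; rewrite in_itv/= andbT => -[]//.
    by move=> ? [].
  apply: measurableI; first by rewrite -[X in measurable X]setTI; exact: measurable_fst.
  apply: measurableI; first by rewrite -[X in measurable X]setTI; exact: measurable_snd.
  rewrite -[X in measurable X]setTI; apply: emeasurable_fun_lt => //.
    by apply: measurableT_comp => //; exact: measurableT_comp.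
  exact: measurableT_comp.
transitivity (\int[mu]_x \int[leb]_l (\1_A (x, l))%:E)%E.
  rewrite integral_mkcond; apply: eq_integral => x _.
  rewrite (_ : (fun l => (\1_A (x, l))%:E) = (fun l => (\1_(xsection A x) l)%:E)); last first.
    by apply/funext => l; rewrite !indicE mem_xsection.
  rewrite integral_indic//; last exact: measurable_xsection.
  rewrite setIT patchE; case: ifPn => [/set_mem Kx|/negP nKx].
    rewrite -[LHS]lebesgue_measure_below//; congr (leb _).
    by apply/seteqP; split => l; rewrite /xsection/= inE /A/= => -[].
  rewrite (_ : xsection A x = set0) ?measure0//.
  apply/seteqP; split => l //; rewrite /xsection/= inE /A/= => -[Kx].
  by exfalso; apply: nKx; rewrite inE.
rewrite (@fubini_tonelli _ _ _ _ _ mu leb (fun z => (\1_A z)%:E))//; last first.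
  exact/measurable_EFinP/measurable_indic.
rewrite [RHS]integral_mkcond; apply: eq_integral => l _ /=.
rewrite (_ : (fun x => (\1_A (x, l))%:E) = (fun x => (\1_(ysection A l) x)%:E)); last first.
  by apply/funext => x; rewrite !indicE mem_ysection.
rewrite integral_indic//; last exact: measurable_ysection.
rewrite setIT patchE; case: ifPn => [/set_mem/=|/negP nl].
  rewrite in_itv/= andbT => l0; congr (mu _).
  by apply/seteqP; split => x; rewrite /ysection/= inE /A/= => -[].
rewrite (_ : ysection A l = set0) ?measure0//.
apply/seteqP; split => x //; rewrite /ysection/= inE /A/= => -[_ l0].
by exfalso; apply: nl; rewrite inE/= in_itv/= l0.
Qed.

Lemma layer_cake_le (K : set X) (h : X -> \bar R) (N : R -> R) :
  measurable K -> measurable_fun setT h -> (forall x, 0 <= h x)%E ->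
  measurable_fun setT N ->
  (forall l : R, 0 < l -> (mu (K `&` [set x | (l%:E < h x)%E]) <= (N l)%:E)%E) ->
  (\int[mu]_(x in K) h x <= \int[leb]_(l in `]0%R, +oo[) (N l)%:E)%E.
Proof.
move=> mK mh h0 mN hN; rewrite layer_cake//; apply: ge0_le_integral => //.
- by apply: measurable_funTS; exact: measurable_tail.
- by apply: measurable_funTS; exact/measurable_EFinP.
- by move=> l /=; rewrite in_itv/= andbT; exact: hN.
Qed.

Lemma layer_cake_eq (K : set X) (h : X -> \bar R) (N : R -> R) :
  measurable K -> measurable_fun setT h -> (forall x, 0 <= h x)%E ->
  (forall l : R, 0 < l -> mu (K `&` [set x | (l%:E < h x)%E]) = (N l)%:E) ->
  (\int[mu]_(x in K) h x = \int[leb]_(l in `]0%R, +oo[) (N l)%:E)%E.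
Proof.
move=> mK mh h0 hN; rewrite layer_cake//; apply: eq_integral => l.
by rewrite inE/= in_itv/= andbT; exact: hN.
Qed.

End layer_cake.

Section powR_integrals.
Context (R : realType).
Local Notation leb := (@lebesgue_measure R).
Implicit Types (a b c x y : R).

(** Zero raised to a negative power is 0 by convention, whence the condition that the smaller
    argument be positive. *)
Lemma le0_ger_powR c x y : c <= 0 -> 0 < x -> x <= y -> y `^ c <= x `^ c.
Proof.
move=> c0 x0 xy; rewrite -[c]opprK !(powRN _ (- c)) lef_pV2 ?posrE ?powR_gt0//.
  by rewrite ge0_ler_powR ?nnegrE ?oppr_ge0// ltW// (lt_le_trans x0).
exact: lt_le_trans xy.
Qed.

Lemma lt0_ler_powR c x y : c < 0 -> 0 < x -> 0 < y ->
  (x `^ c <= y `^ c) = (y <= x).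
Proof.
move=> c0 x0 y0; apply/idP/idP => [xy|]; last exact: (le0_ger_powR (ltW c0)).
have rootK z : 0 < z -> (z `^ c) `^ c^-1 = z.
  by move=> z0; rewrite -powRrM mulfV ?lt_eqF// powRr1// ltW.
rewrite -(rootK x x0) -(rootK y y0); apply: le0_ger_powR => //.
  by rewrite invr_le0 ltW.
exact: powR_gt0.
Qed.

Lemma continuous_powR c x : 0 < x -> {for x, continuous (@powR R ^~ c)}.
Proof.
move=> x0; apply: differentiable_continuous; apply/derivable1_diffP.
by apply: derivable_powR; rewrite in_itv/= x0.
Qed.

Lemma cvg_powR_infty c : c < 0 -> x `^ c @[x --> +oo] --> (0 : R).
Proof.
move=> c0; apply/cvgrPdist_le => e e0; near=> x.
rewrite sub0r normrN ger0_norm ?powR_ge0//.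
rewrite -[leRHS](powRr1 (ltW e0)) -(mulVf (negbT (lt_eqF c0))) powRrM.
apply: le0_ger_powR; rewrite ?powR_gt0 ?(ltW c0)//.
Unshelve. all: by end_near. Qed.

Let primitive c x := x `^ (c + 1) / (c + 1).

Let is_derive_primitive c x : c + 1 != 0 -> 0 < x ->
  is_derive x 1 (primitive c) (x `^ c).
Proof.
move=> c1 x0.
have -> : x `^ c = (c + 1)^-1 *: ((c + 1) * x `^ (c + 1 - 1)).
  by rewrite addrK /GRing.scale/= mulKf.
rewrite (_ : primitive c = (c + 1)^-1 *: (@powR R ^~ (c + 1))).
  exact/is_deriveZ/is_derive1_powR.
by apply/funext => z; rewrite /primitive mulrC.
Qed.

Let cvg_primitive c x : 0 < x -> primitive c z @[z --> x] --> primitive c x.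
Proof. by move=> x0; apply: cvgMl; exact: continuous_powR. Qed.

Lemma integral_powR_itv c a b : 0 < a -> a <= b -> c + 1 != 0 ->
  (\int[leb]_(x in `[a, b]) (x `^ c)%:E =
   ((b `^ (c + 1) - a `^ (c + 1)) / (c + 1))%:E)%E.
Proof.
move=> a0; rewrite le_eqVlt => /predU1P[<-|ab] c1.
  by rewrite set_itv1 integral_set1 subrr mul0r.
have b0 := lt_trans a0 ab.
rewrite (@continuous_FTC2 _ _ (primitive c))//.
- by rewrite -EFinB mulrBl.
- apply/continuous_within_itvP => //; split.
  + move=> x; rewrite in_itv/= => /andP[ax _].
    by apply: continuous_powR; exact: lt_trans ax.
  + by apply: cvg_at_right_filter; exact: continuous_powR.
  + by apply: cvg_at_left_filter; exact: continuous_powR.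
- split.
  + move=> x; rewrite in_itv/= => /andP[ax _].
    by have [] := is_derive_primitive c1 (lt_trans a0 ax).
  + by apply: cvg_at_right_filter; exact: cvg_primitive.
  + by apply: cvg_at_left_filter; exact: cvg_primitive.
- move=> x; rewrite in_itv/= => /andP[ax _].
  by rewrite derive1E; have [] := is_derive_primitive c1 (lt_trans a0 ax).
Qed.

Lemma integral_powR_infty c a : 0 < a -> c + 1 < 0 ->
  (\int[leb]_(x in `[a, +oo[) (x `^ c)%:E = (a `^ (c + 1) / - (c + 1))%:E)%E.
Proof.
move=> a0 c1; have c1n : c + 1 != 0 by rewrite lt_eqF.
rewrite (@ge0_continuous_FTC2y _ _ (primitive c) _ 0)//.
- by rewrite sub0e /primitive invrN mulrN.
- by move=> x _; exact: powR_ge0.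
- apply/continuous_within_itvcyP; split.
  + move=> x; rewrite in_itv/= => /andP[ax _].
    by apply: continuous_powR; exact: lt_trans ax.
  + by apply: cvg_at_right_filter; exact: continuous_powR.
- by rewrite -[X in _ --> X](mul0r (c + 1)^-1); apply: cvgMl; exact: cvg_powR_infty.
- by move=> x ax; have [] := is_derive_primitive c1n (lt_trans a0 ax).
- by apply: cvg_at_right_filter; exact: cvg_primitive.
- move=> x; rewrite in_itv/= => /andP[ax _].
  by rewrite derive1E; have [] := is_derive_primitive c1n (lt_trans a0 ax).
Qed.

(** The common shape of all the tails below: a constant, a power, then a decaying power. Taking
    [a = b] removes the middle piece, and [A] and [c] are then set to 0. *)
Lemma integral_piecewise_powR (g : R -> R) a b k A c B c' :
  measurable_fun setT g -> (forall x, 0 < x -> 0 <= g x) ->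
  0 < a -> a <= b -> 0 <= A -> 0 <= B -> c + 1 != 0 -> c' + 1 < 0 ->
  (forall x, 0 < x -> x <= a -> g x = k) ->
  (forall x, a < x -> x <= b -> g x = A * x `^ c) ->
  (forall x, b < x -> g x = B * x `^ c') ->
  (\int[leb]_(x in `]0%R, +oo[) (g x)%:E =
   (k * a + A * ((b `^ (c + 1) - a `^ (c + 1)) / (c + 1))
    + B * (b `^ (c' + 1) / - (c' + 1)))%:E)%E.
Proof.
move=> mg g0 a0 ab A0 B0 c1 c'1 ga gab gb.
have b0 := lt_le_trans a0 ab.
have mgE D : measurable_fun D (EFin \o g) by exact/measurable_EFinP/measurable_funTS.
have mpow D e : measurable_fun D (fun x => (x `^ e)%:E).
  by apply/measurable_EFinP/measurable_funTS; exact: measurable_powR.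
have -> : `]0%R, +oo[%classic = `]0, a] `|` (`]a, b] `|` `]b, +oo[) :> set R.
  by rewrite -!itv_bndbnd_setU ?bnd_simp ?(ltW a0).
have pos0a y : y \in `]0, a] -> 0 < y by rewrite in_itv/= => /andP[].
have posab y : y \in `]a, b] -> 0 < y.
  by rewrite in_itv/= => /andP[ay _]; exact: lt_trans ay.
have posb y : y \in `]b, +oo[ -> 0 < y.
  by rewrite in_itv/= andbT => by_; exact: lt_trans by_.
rewrite ge0_integral_setU//=; last 3 first.
- exact: mgE.
- move=> x Dx; rewrite lee_fin g0//.
  by case: Dx => [|[]]; [exact: pos0a|exact: posab|exact: posb].
- apply/disj_set2P/seteqP; split => x //= -[]; rewrite !in_itv/= andbT.
  move=> /andP[_ xa] [/andP[+ _]|]; rewrite ltNge ?xa//.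
  by rewrite (le_trans xa).
rewrite ge0_integral_setU//=; last 3 first.
- exact: mgE.
- by move=> x Dx; rewrite lee_fin g0//; case: Dx; [exact: posab|exact: posb].
- apply/disj_set2P/seteqP; split => x //= -[]; rewrite !in_itv/= andbT.
  by move=> /andP[_ xb]; rewrite ltNge xb.
rewrite !EFinD -addeA; congr (_ + (_ + _))%E.
- rewrite (eq_integral (cst k%:E)); last first.
    by move=> x /[!inE]/=; rewrite in_itv/= => /andP[x0 xa]; rewrite ga.
  by rewrite integral_cst//= lebesgue_measure_itv/= lte_fin a0 oppr0 adde0 EFinM.
- transitivity (\int[leb]_(x in `]a, b]) (A%:E * (x `^ c)%:E))%E.
    apply: eq_integral => x; rewrite inE/= in_itv/= => /andP[x0 xa].
    by rewrite gab// EFinM.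
  rewrite ge0_integralZl//; [|exact: mpow|by move=> x _; rewrite lee_fin powR_ge0].
  by rewrite integral_itv_obnd_cbnd ?mpow// integral_powR_itv// -EFinM.
- transitivity (\int[leb]_(x in `]b, +oo[) (B%:E * (x `^ c')%:E))%E.
    apply: eq_integral => x; rewrite inE/= in_itv/= andbT => bx.
    by rewrite gb// EFinM.
  rewrite ge0_integralZl//; [|exact: mpow|by move=> x _; rewrite lee_fin powR_ge0].
  by rewrite integral_itv_obnd_cbnd ?mpow// integral_powR_infty// -EFinM.
- exact: measurableU.
Qed.

End powR_integrals.

(** * Closed forms of the tail integrals *)

Section tail_integrals.
Context (R : realType).
Local Notation leb := (@lebesgue_measure R).
Implicit Types (p q f k m x l : R).

Lemma powR_rootK x p : 0 <= x -> 0 < p -> (x `^ p^-1) `^ p = x.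
Proof. by move=> x0 p0; rewrite -powRrM mulVf ?lt0r_neq0// powRr1. Qed.

Lemma powR_le_root x k p : 0 <= x -> 0 <= k -> 0 < p ->
  (x `^ p <= k) = (x <= k `^ p^-1).
Proof.
move=> x0 k0 p0; apply/idP/idP => h.
  rewrite -[leLHS](powRr1 x0) -(mulfV (lt0r_neq0 p0)) powRrM.
  by rewrite ge0_ler_powR ?nnegrE ?powR_ge0 ?invr_ge0// ltW.
rewrite -[leRHS](powRr1 k0) -(mulVf (lt0r_neq0 p0)) powRrM.
by rewrite ge0_ler_powR ?nnegrE ?powR_ge0// ltW.
Qed.

Lemma mulr_powR x a b : 0 < x -> x `^ a * x `^ b = x `^ (a + b).
Proof. by move=> x0; rewrite powRD // lt0r_neq0 ?implybT. Qed.

Lemma powR_le_linear x f p : 0 < x -> 0 < f -> 1 < p ->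
  (x `^ p <= f * x) = (x <= f `^ (p - 1)^-1).
Proof.
move=> x0 f0 p1; rewrite -(mulr_powRB1 (ltW x0)) ?(lt_trans _ p1)//.
by rewrite mulrC ler_pM2r// powR_le_root// ?ltW// subr_gt0.
Qed.

Lemma linear_le_powR x f p : 0 < x -> 0 < f -> 1 < p ->
  f `^ (p - 1)^-1 <= x -> f * x <= x `^ p.
Proof.
move=> x0 f0 p1 fx; have pm1 : 0 < p - 1 by rewrite subr_gt0.
rewrite -(mulr_powRB1 (ltW x0)) ?(lt_trans _ p1)// mulrC ler_pM2l//.
rewrite (_ : f = (f `^ (p - 1)^-1) `^ (p - 1)); last first.
  by rewrite -powRrM mulVf ?lt0r_neq0// powRr1// ltW.
by rewrite ge0_ler_powR ?nnegrE ?powR_ge0// ltW.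
Qed.

Lemma measurable_scale_powR (c e : R) : measurable_fun setT (fun l => c * l `^ e).
Proof. by apply: measurable_funM => //; exact: measurable_powR. Qed.

(** Here [m] stands for the measure of a set and the power for the weak-type tail of a function of
    quasi-norm F = (p-1)/p. The two cross at F m^(-1/p), and the integral is p/(p-1) times [m] times
    this point, so that F cancels the constant. *)
Lemma integral_min_powR p m : 1 < p -> 0 <= m ->
  (\int[leb]_(l in `]0%R, +oo[)
     (Num.min m (((p - 1) / p) `^ p * l `^ (- p)))%:E = (m `^ (1 - p^-1))%:E)%E.
Proof.
move=> p1; have p0 : 0 < p by exact: lt_trans p1.
have pm1 : 0 < p - 1 by rewrite subr_gt0.
have ip1 : p^-1 < 1 by rewrite invf_lt1.
set F := (p - 1) / p; have F0 : 0 < F by rewrite divr_gt0.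
(* The case of measure zero is separate: the negative power in the crossing point would be the
   default value 0, while the piecewise formula asks for a positive breakpoint. *)
rewrite le_eqVlt => /predU1P[<-|m0].
  rewrite powR0 ?subr_eq0 ?gt_eqF//; apply: integral0_eq => l _.
  by congr EFin; apply/min_idPl; rewrite mulr_ge0 ?powR_ge0.
pose a := F * m `^ (- p^-1); have a0 : 0 < a by rewrite mulr_gt0 ?powR_gt0.
have aE : F `^ p * a `^ (- p) = m.
  rewrite [a `^ _]powRM ?powR_ge0 ?(ltW F0)// mulrA mulr_powR// subrr powRr0 mul1r.
  by rewrite -powRrM mulrNN mulVf ?lt0r_neq0// powRr1// ltW.
rewrite (@integral_piecewise_powR _ _ a a m 0 0 (F `^ p) (- p))//.
- rewrite -!mulr_powR// !powRr1 ?(ltW a0) ?(ltW m0)// mul0r addr0.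
  rewrite [_ `^ p * _]mulrA [_ `^ p * _]mulrA aE /a /F; congr EFin.
  by field; rewrite addrC subr_eq0 lt_eqF// lt0r_neq0.
- exact: (measurable_minr (measurable_cst m) (measurable_scale_powR _ _)).
- by move=> l l0; rewrite le_min ltW//= mulr_ge0 ?powR_ge0.
- by rewrite powR_ge0.
- by rewrite addrC subr_lt0.
- move=> l l0 la; apply/min_idPl; rewrite -{1}aE ler_wpM2l ?powR_ge0//.
  by rewrite le0_ger_powR// oppr_le0 ltW.
- by move=> l al la; move: (lt_le_trans al la); rewrite ltxx.
- move=> l al; apply/min_idPr; rewrite -[leRHS]aE ler_wpM2l ?powR_ge0//.
  by rewrite le0_ger_powR// ?oppr_le0 ltW.
Qed.

Section weak_strong.
Context (p q f k : R) (q1 : 1 < q) (qp : q < p) (f0 : 0 < f) (k0 : 0 <= k).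
(** The bound for the measure of the part of K where the q-th power of the maximal function exceeds
    [l]. In the variable x = l^(-1/q) its three terms are k, f x and x^p, and x^p is below f x
    exactly up to x = f^(1/(p-1)). *)
Let tail l := Num.min k (Num.min (f * l `^ (- q^-1)) (l `^ (- (p / q)))).

Let q0 : 0 < q. Proof. exact: lt_trans q1. Qed.
Let p0 : 0 < p. Proof. exact: lt_trans qp. Qed.
Let p1 : 1 < p. Proof. exact: lt_trans qp. Qed.

Let measurable_tail : measurable_fun setT tail.
Proof.
exact: (measurable_minr (measurable_cst k)
  (measurable_minr (measurable_scale_powR _ _) (measurable_powR _))).
Qed.

Let tail_ge0 l : 0 < l -> 0 <= tail l.
Proof. by move=> l0; rewrite !le_min k0 powR_ge0 mulr_ge0 ?powR_ge0// ltW. Qed.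

Let powRpq l : l `^ (- (p / q)) = (l `^ (- q^-1)) `^ p.
Proof. by rewrite -powRrM; congr (_ `^ _); rewrite mulNr mulrC. Qed.

Let root_le x l : 0 < x -> x `^ (- q) <= l -> l `^ (- q^-1) <= x.
Proof.
move=> x0 xl; apply: le_trans (le0_ger_powR _ _ xl) _.
- by rewrite oppr_le0 invr_ge0 ltW.
- exact: powR_gt0.
- by rewrite -powRrM mulrNN mulfV ?lt0r_neq0// powRr1// ltW.
Qed.

Let root_ge x l : 0 < x -> 0 < l -> l <= x `^ (- q) -> x <= l `^ (- q^-1).
Proof.
move=> x0 l0 xl; apply: le_trans (le0_ger_powR _ l0 xl); last first.
  by rewrite oppr_le0 invr_ge0 ltW.
by rewrite -powRrM mulrNN mulfV ?lt0r_neq0// powRr1// ltW.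
Qed.

Let root_powRN x e : 0 < x -> (x `^ (- q)) `^ (- (e / q)) = x `^ e.
Proof.
by move=> x0; rewrite -powRrM mulrNN mulrC divfK// lt0r_neq0.
Qed.

(** For such [k] the term f x is never strictly the smallest: at x = k^(1/p), where x^p reaches k,
    it is still at least k. A single breakpoint remains. *)
Lemma integral_tail_small : k <= f `^ (p / (p - 1)) ->
  (\int[leb]_(l in `]0%R, +oo[) (tail l)%:E =
   (p / (p - q) * k `^ (1 - q / p))%:E)%E.
Proof.
have pm1 : 0 < p - 1 by rewrite subr_gt0.
have pq0 : 0 < p - q by rewrite subr_gt0.
move: k0; rewrite le_eqVlt => /predU1P[kE _|kp kf].
  rewrite -kE powR0 ?mulr0; last by rewrite subr_eq0 eq_sym lt_eqF// ltr_pdivrMr// mul1r.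
  apply: integral0_eq => l; rewrite /= in_itv/= => /andP[l0 _].
  rewrite /tail -kE; congr EFin; apply/min_idPl.
  by rewrite le_min powR_ge0 mulr_ge0 ?powR_ge0// ltW.
pose x := k `^ p^-1; have x0 : 0 < x by exact: powR_gt0.
have xp : x `^ p = k by rewrite -powRrM mulVf ?lt0r_neq0// powRr1.
have x1 : x <= f `^ (p - 1)^-1.
  have -> : f `^ (p - 1)^-1 = (f `^ (p / (p - 1))) `^ p^-1.
    by rewrite -powRrM; congr (_ `^ _); field; rewrite !lt0r_neq0.
  by rewrite ge0_ler_powR ?nnegrE ?powR_ge0 ?invr_ge0// ltW.
have xf : k <= f * x by rewrite -{1}xp powR_le_linear.
pose a := x `^ (- q); have a0 : 0 < a by exact: powR_gt0.
rewrite (@integral_piecewise_powR _ _ a a k 0 0 1 (- (p / q)))//.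
- rewrite mul0r addr0 mul1r -[a `^ _]mulr_powR// (powRr1 (ltW a0)) root_powRN// xp.
  have -> : k `^ (1 - q / p) = k * a.
    rewrite /a /x -powRrM -{2}[k](powRr1 k0) mulr_powR//.
    by congr (_ `^ _); rewrite mulrN [p^-1 * q]mulrC.
  by congr EFin; field; rewrite [- p + q]addrC !subr_eq0 (gt_eqF qp) (lt_eqF qp) lt0r_neq0.
- by rewrite addrC subr_lt0 ltr_pdivlMr// mul1r.
- move=> l l0 /(root_ge x0 l0) xl; apply/min_idPl; rewrite le_min; apply/andP; split.
    by rewrite (le_trans xf)// ler_pM2l.
  by rewrite powRpq -xp ge0_ler_powR ?nnegrE ?powR_ge0// ltW.
- by move=> l al la; move: (lt_le_trans al la); rewrite ltxx.
- move=> l al; have xl := root_le x0 (ltW al).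
  have l0 := lt_trans a0 al.
  rewrite /tail mul1r min_r; last first.
    rewrite ge_min; apply/orP; right; rewrite powRpq -xp.
    by rewrite ge0_ler_powR ?nnegrE ?powR_ge0// ltW.
  apply/min_idPr; rewrite powRpq powR_le_linear ?powR_gt0//.
  exact: le_trans x1.
Qed.

(** Now f x is the minimum between x = f^(1/(p-1)), where it leaves x^p, and y = k/f, where it
    reaches k. The hypothesis on [k] says that x <= y, and the breakpoints in [l] are the powers of
    y and x with exponent -q. *)
Lemma integral_tail_large : f `^ (p / (p - 1)) <= k ->
  (\int[leb]_(l in `]0%R, +oo[) (tail l)%:E =
   (q * (p - 1) / ((p - q) * (q - 1)) * f `^ ((p - q) / (p - 1))
        - 1 / (q - 1) * (k `^ (1 - q) * f `^ q))%:E)%E.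
Proof.
have pm1 : 0 < p - 1 by rewrite subr_gt0.
have qm1 : 0 < q - 1 by rewrite subr_gt0.
have pq0 : 0 < p - q by rewrite subr_gt0.
move=> fk; have kp : 0 < k by apply: lt_le_trans fk; exact: powR_gt0.
pose x := f `^ (p - 1)^-1; have x0 : 0 < x by exact: powR_gt0.
have xp : x `^ p = f `^ (p / (p - 1)) by rewrite -powRrM mulrC.
have xf : x `^ p = f * x.
  by rewrite xp -{2}(powRr1 (ltW f0)) mulr_powR//; congr (_ `^ _); field; rewrite lt0r_neq0.
pose y := k / f; have y0 : 0 < y by rewrite divr_gt0.
have yf : f * y = k by rewrite mulrC divfK// lt0r_neq0.
have xy : x <= y by rewrite -(ler_pM2l f0) yf -xf xp.
pose a := y `^ (- q); have a0 : 0 < a by exact: powR_gt0.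
pose b := x `^ (- q); have b0 : 0 < b by exact: powR_gt0.
have ab : a <= b by rewrite le0_ger_powR// oppr_le0 ltW.
rewrite (@integral_piecewise_powR _ _ a b k f (- q^-1) 1 (- (p / q)))//.
- have rootE z : 0 < z -> (z `^ (- q)) `^ (- q^-1) = z.
    by move=> z0; rewrite -{1}[q^-1]mul1r root_powRN// powRr1// ltW.
  rewrite mul1r -[a `^ _]mulr_powR// -[b `^ (- q^-1 + 1)]mulr_powR//.
  rewrite -[b `^ (- (p / q) + 1)]mulr_powR//.
  rewrite (powRr1 (ltW a0)) (powRr1 (ltW b0)) root_powRN// !rootE//.
  have -> : k `^ (1 - q) * f `^ q = a * k.
    rewrite /a /y powRM ?invr_ge0 ?(ltW f0)// -powR_inv1 ?(ltW f0)//.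
    rewrite -powRrM mulrNN mul1r mulrAC -{3}[k](powRr1 k0) mulr_powR//.
    by rewrite addrC.
  have -> : f `^ ((p - q) / (p - 1)) = b * (f * x).
    rewrite -xf /b mulr_powR// /x -powRrM; congr (_ `^ _).
    by rewrite [- q + p]addrC mulrC.
  rewrite xf; congr EFin; rewrite -yf; field.
  by rewrite [- p + q]addrC !subr_eq0 (gt_eqF q1) (gt_eqF qp) (lt_eqF qp) lt0r_neq0.
- exact: ltW.
- by rewrite addrC subr_eq0 eq_sym lt_eqF// invf_lt1.
- by rewrite addrC subr_lt0 ltr_pdivlMr// mul1r.
- move=> l l0 /(root_ge y0 l0) xl; apply/min_idPl; rewrite le_min.
  have fl : k <= f * l `^ (- q^-1) by rewrite -yf ler_pM2l.
  rewrite fl (le_trans fl)// powRpq linear_le_powR ?powR_gt0//.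
  exact: le_trans xl.
- move=> l al lb; have l0 := lt_trans a0 al.
  have xl := root_ge x0 l0 lb; have ly := root_le y0 (ltW al).
  rewrite /tail min_r; last by rewrite ge_min -yf ler_pM2l// ly.
  by apply/min_idPl; rewrite powRpq linear_le_powR ?powR_gt0.
- move=> l bl; have l0 := lt_trans b0 bl; have lx := root_le x0 (ltW bl).
  rewrite mul1r /tail min_r; last first.
    by rewrite ge_min -yf ler_pM2l// (le_trans lx).
  by apply/min_idPr; rewrite powRpq powR_le_linear ?powR_gt0.
Qed.

End weak_strong.
End tail_integrals.

(** * Upper bound *)

Lemma lt_poweR (R : realType) (q l : R) (y : \bar R) :
  0 < q -> 0 <= l -> (0 <= y)%E ->
  (l%:E < y `^ q)%E = ((l `^ q^-1)%:E < y)%E.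
Proof.
move=> q0 l0; case: y => [y| |]//; last by rewrite poweRyr ?lt0r_neq0// !ltry.
by rewrite poweR_EFin lee_fin !lte_fin => y0; rewrite !ltNge powR_le_root.
Qed.

Section upper_bound.
Context d (X : measurableType d) (R : realType) (mu : probability X R).
Context (p : R) (p1 : 1 < p) (phi : X -> R) (mphi : measurable_fun setT phi).
Context (phi0 : forall x, 0 <= phi x).
Context (phiF : weak_Lnorm mu p phi = ((p - 1) / p)%:E).

Let p0 : 0 < p. Proof. exact: lt_trans p1. Qed.
Let F0 : 0 <= (p - 1) / p.
Proof. by rewrite divr_ge0 ?subr_ge0 ?ltW. Qed.

Let fin_mu (A : set X) : measurable A -> mu A \is a fin_num.
Proof. by move=> mA; exact: fin_num_measure. Qed.

Let mEphi : measurable_fun setT (EFin \o phi).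
Proof. exact/measurable_EFinP. Qed.

Lemma weak_Lnorm_tail (l : R) : 0 < l ->
  (mu [set x | l%:E < (phi x)%:E] <= (((p - 1) / p) `^ p * l `^ (- p))%:E)%E.
Proof.
move=> l0; have mA : measurable [set x | (l <= phi x)%R].
  rewrite (_ : [set _ | _] = setT `&` [set x | (l%:E <= (EFin \o phi) x)%E]).
    exact: emeasurable_fun_c_infty.
  by rewrite setTI; apply/seteqP; split => x /=; rewrite lee_fin.
apply: (@le_trans _ _ (mu [set x | (l <= phi x)%R])).
  apply: le_measure; rewrite ?inE//; first exact: (measurable_gt _ mEphi).
  by move=> x /=; rewrite lte_fin; exact: ltW.
have : (l%:E * mu [set x | (l <= phi x)%R] `^ p^-1 <= ((p - 1) / p)%:E)%E.
  by rewrite -phiF; apply: ereal_sup_ubound; exists l.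
rewrite -(fineK (fin_mu mA)) poweR_EFin -EFinM !lee_fin.
set m := fine _; have m0 : 0 <= m by rewrite fine_ge0.
rewrite mulrC -ler_pdivlMr// -(powR_inv1 (ltW l0)) => h.
rewrite -[leLHS](powR_rootK m0 p0) -[- p]mulN1r powRrM -powRM ?powR_ge0//.
by rewrite ge0_ler_powR ?nnegrE ?powR_ge0 ?(mulr_ge0 F0) ?powR_ge0// ltW.
Qed.

(** The part of [E] where [phi] exceeds a height has measure at most [mu E] and at most the
    weak-type tail; the layer cake integral of the smaller bound is already computed. *)
Lemma integral_weak_Lnorm (E : set X) : measurable E ->
  (\int[mu]_(x in E) (phi x)%:E <= (fine (mu E) `^ (1 - p^-1))%:E)%E.
Proof.
move=> mE; rewrite -integral_min_powR// ?fine_ge0//.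
apply: (layer_cake_le mE mEphi) => //.
  exact: (measurable_minr (measurable_cst _) (measurable_scale_powR _ _)).
move=> l l0; have mA := measurable_gt l%:E mEphi.
rewrite EFin_min fineK ?fin_mu// le_min; apply/andP; split.
  by apply: le_measure; rewrite ?inE//; exact: measurableI.
apply: le_trans (weak_Lnorm_tail l0).
by apply: le_measure; rewrite ?inE//; exact: measurableI.
Qed.

Context (TT : set (set X)) (C : set X -> set (set X)).
Context (treeC : is_tree_with mu TT C).
Context (f : R) (f0 : 0 < f) (phif : (\int[mu]_x (phi x)%:E = f%:E)%E).
Local Notation M := (dyadic_maximal mu TT phi).

(** If m is the measure of the level set, the weak type inequality gives both s m <= f and s m <=
    m^(1-1/p). Dividing the second by m, when m is positive, yields m <= s^(-p). *)
Lemma dyadic_maximal_tail (s : R) : 0 < s ->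
  (mu [set x | (s%:E < M x)%E] <= (Num.min (f / s) (s `^ (- p)))%:E)%E.
Proof.
move=> s0; have mE := measurable_dyadic_maximal_gt treeC phi s.
have := dyadic_maximal_weak11 treeC mphi phi0 (ltW s0).
set E := [set x | _] in mE *; rewrite -(fineK (fin_mu mE)) => wE.
have m0 : 0 <= fine (mu E) by rewrite fine_ge0.
rewrite lee_fin le_min; apply/andP; split.
  rewrite ler_pdivlMr// mulrC -lee_fin EFinM (le_trans wE)// -phif.
  by apply: ge0_subset_integral => // x _; rewrite lee_fin.
have := le_trans wE (integral_weak_Lnorm mE).
rewrite -EFinM lee_fin; move: m0; rewrite le_eqVlt => /predU1P[<- _|m0].
  exact: powR_ge0.
rewrite -mulr_powR// powRr1 ?(ltW m0)// mulrC ler_pM2l// => sm.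
rewrite -[leLHS](powR_rootK (ltW m0) p0) -powRrM -mulrNN powRrM.
by rewrite le0_ger_powR// oppr_le0 ltW.
Qed.

Lemma integral_dyadic_maximal_le (q k : R) (K : set X) :
  1 < q -> q < p -> 0 <= k -> measurable K -> mu K = k%:E ->
  (\int[mu]_(x in K) (M x `^ q) <= \int[@lebesgue_measure R]_(l in `]0%R, +oo[)
     (Num.min k (Num.min (f * l `^ (- q^-1)) (l `^ (- (p / q)))))%:E)%E.
Proof.
move=> q1 qp k0 mK Kk; have q0 : 0 < q by exact: lt_trans q1.
have M0 := dyadic_maximal_ge0 treeC phi0.
have mM : measurable_fun setT (fun x => M x `^ q)%E.
  by apply: (measurableT_comp (measurable_poweR _)); exact: (measurable_dyadic_maximal treeC).
apply: (layer_cake_le mK mM) => //.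
- by move=> x; exact: poweR_ge0.
- exact: (measurable_minr (measurable_cst k)
    (measurable_minr (measurable_scale_powR _ _) (measurable_powR _))).
move=> l l0; have mA := measurable_gt l%:E mM.
rewrite EFin_min -Kk le_min; apply/andP; split.
  by apply: le_measure; rewrite ?inE//; exact: measurableI.
have s0 : 0 < l `^ q^-1 by exact: powR_gt0.
have -> : f * l `^ (- q^-1) = f / l `^ q^-1 by rewrite powRN.
have -> : l `^ (- (p / q)) = (l `^ q^-1) `^ (- p).
  by rewrite -powRrM mulrN mulrC.
apply: le_trans (dyadic_maximal_tail s0).
apply: le_measure; rewrite ?inE//; first exact: measurableI.
- exact: (measurable_dyadic_maximal_gt treeC).
- by move=> x [_ /=]; rewrite lt_poweR// ltW.
Qed.

End upper_bound.

(** * Uniform variables adapted to a chain of sets *)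

(** [W] is the sum of 3^(-k-1) over the [k] with [x] in [G k]. With digits 0 and 1 in base 3, all
    digits after a given place weigh together at most half of that place, so the first differing
    digit decides strictly; in base 2 ties could occur. *)
Lemma lexicographic_code d (X : measurableType d) (R : realType)
    (G : nat -> set X) : (forall n, measurable (G n)) ->
  exists W : X -> R, [/\ measurable_fun setT W,
    forall x, 0 <= W x <= 1 &
    forall x y n, (forall j, (j < n)%N -> G j x <-> G j y) ->
      ~ G n x -> G n y -> W x < W y].
Proof.
move=> mG; pose t n : R := 3^-1 ^+ n.
have t0 n : 0 < t n by rewrite exprn_gt0.
have tS n : t n = 3 * t n.+1 by rewrite /t exprS mulVKf.
pose S n x := \sum_(k < n) t k.+1 * \1_(G k) x.
have SS n x : S n.+1 x = S n x + t n.+1 * \1_(G n) x by rewrite /S big_ord_recr.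
have ind01 n x : 0 <= (\1_(G n) x : R) <= 1.
  by rewrite indicE; case: (_ \in _); rewrite ?lexx ?ler01.
have ndS x : nondecreasing_seq (S^~ x).
  apply/nondecreasing_seqP => n; by rewrite SS lerDl mulr_ge0 ?(ltW (t0 _)).
have niT x : nonincreasing_seq (fun n => S n x + t n / 2).
  apply/nonincreasing_seqP => n; rewrite SS (tS n).
  by have := ind01 n x; have := t0 n.+1; nra.
have ST n m x : (n <= m)%N -> S m x <= S n x + t n / 2.
  move=> nm; apply: le_trans (niT x _ _ nm).
  by rewrite lerDl divr_ge0// ltW.
have cS x : cvgn (S^~ x).
  apply: nondecreasing_is_cvgn; first exact: ndS.
  by exists (S 0%N x + t 0%N / 2) => _ [n _ <-]; exact: ST.
pose W x := limn (S^~ x).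
have W_ge n x : S n x <= W x by apply: nondecreasing_cvgn_le; [exact: ndS|exact: cS].
have W_le n x : W x <= S n x + t n / 2.
  apply: limr_le; first exact: cS.
  by exists n => // m nm; exact: ST.
exists W; split.
- apply: (@measurable_fun_cvg _ _ _ _ S) => [n|x _]; last exact: cS.
  apply: measurable_sum => k; apply: measurable_funM => //.
- move=> x; apply/andP; split; first by rewrite (le_trans _ (W_ge 0%N x))// /S big_ord0.
  by apply: (le_trans (W_le 0%N x)); rewrite /S big_ord0 add0r /t expr0; lra.
- move=> x y n agree Gx Gy; apply: (le_lt_trans (W_le n.+1 x)).
  apply: (lt_le_trans _ (W_ge n.+1 y)).
  have -> : S n.+1 x = S n y.
    rewrite SS indicE memNset// mulr0 addr0; apply: eq_bigr => k _.
    rewrite !indicE; congr (_ * (_ : bool)%:R).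
    by apply/idP/idP => /set_mem h; apply/mem_set; apply/agree.
  rewrite SS indicE mem_set// mulr1 ltrD2l.
  by rewrite ltr_pdivrMr// mulr_natr mulr2n ltrDl.
Qed.

Section probability_integral_transform.
Context d (X : measurableType d) (R : realType) (mu : probability X R).
Context (W : X -> R) (mW : measurable_fun setT W) (W01 : forall x, 0 <= W x <= 1).
Context (W_atomless : forall w, mu [set x | W x = w] = 0%E).

Let mle w : measurable [set x | W x <= w].
Proof.
rewrite -[X in measurable X]setTI -preimage_itvNyc.
by apply: mW => //; exact: measurable_itv.
Qed.

Let mlt w : measurable [set x | W x < w].
Proof.
rewrite -[X in measurable X]setTI -preimage_itvNyo.
by apply: mW => //; exact: measurable_itv.
Qed.

Let G w := fine (mu [set x | W x <= w]).

Let GE w : (G w)%:E = mu [set x | W x <= w].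
Proof. by rewrite fineK// fin_num_measure. Qed.

Let G_nd : nondecreasing_fun G.
Proof.
move=> v w vw; rewrite fine_le ?fin_num_measure//.
by apply: le_measure; rewrite ?inE// => x /= /le_trans; apply.
Qed.

Definition pit x := G (W x).

Lemma measurable_pit : measurable_fun setT pit.
Proof. by apply: measurableT_comp => //; exact: nondecreasing_measurable. Qed.

Lemma pit_le (A : set X) x : measurable A ->
  (forall y, W y <= W x -> A y) -> ((pit x)%:E <= mu A)%E.
Proof. by move=> mA WA; rewrite GE; apply: le_measure; rewrite ?inE. Qed.

Lemma pit_ge (A : set X) x : measurable A ->
  (forall y, A y -> W y <= W x) -> (mu A <= (pit x)%:E)%E.
Proof. by move=> mA WA; rewrite GE; apply: le_measure; rewrite ?inE. Qed.

Lemma pit_ge0 x : 0 <= pit x.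
Proof. by rewrite fine_ge0. Qed.

Lemma pit_le1 x : pit x <= 1.
Proof. by rewrite -lee_fin GE probability_le1. Qed.

Let mpit t : measurable [set x | pit x <= t].
Proof.
rewrite -[X in measurable X]setTI -preimage_itvNyc.
by apply: measurable_pit => //; exact: measurable_itv.
Qed.

Let mpit_lt t : measurable [set x | pit x < t].
Proof.
rewrite -[X in measurable X]setTI -preimage_itvNyo.
by apply: measurable_pit => //; exact: measurable_itv.
Qed.

Let le_cut w : mu [set x | W x <= w] = mu [set x | W x < w].
Proof.
have -> : [set x | W x <= w] = [set x | W x < w] `|` [set x | W x = w].
  apply/seteqP; split => x /=; first by rewrite le_eqVlt => /predU1P[->|]; [right|left].
  by case=> [/ltW|->].
rewrite measureU//; first by rewrite [X in (_ + X)%E](W_atomless w) adde0.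
  by rewrite -[X in measurable X]setTI; exact: (mW measurableT (measurable_set1 w)).
by apply/seteqP; split => x //= [] /[swap] ->; rewrite ltxx.
Qed.

Lemma pit_uniform t : 0 <= t <= 1 -> mu [set x | pit x <= t] = t%:E.
Proof.
move=> /andP[t0]; rewrite le_eqVlt => /predU1P[->|t1].
  rewrite (_ : [set _ | _] = setT) ?probability_setT//.
  by apply/seteqP; split => x //= _; exact: pit_le1.
(* [w0] is the quantile at [t]. [T] contains -1, where the distribution function vanishes, and is
   bounded by 1, from where on that function is 1 and thus above [t]; for this the case [t = 1] has
   been settled first. *)
pose T := [set w | G w <= t]; pose w0 := sup T.
have T1 : ubound T 1.
  move=> w; apply: contraPP => /negP; rewrite -ltNge => /ltW w1; apply/negP.
  rewrite -ltNge (lt_le_trans t1)// /G (_ : [set _ | _] = setT) ?probability_setT//.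
  by apply/seteqP; split => x //= _; case/andP: (W01 x) => _ /le_trans; apply.
have supT : has_sup T.
  split; last by exists 1.
  exists (-1); rewrite /T/= /G (_ : [set _ | _] = set0) ?measure0//.
  apply/seteqP; split => x //=; case/andP: (W01 x) => Wx0 _.
  by move=> /(le_trans Wx0); rewrite oppr_ge0 ler10.
have belowT w : w < w0 -> G w <= t.
  move=> /(sup_gt supT.1)[v Tv wv]; apply: le_trans Tv; apply: G_nd; exact: ltW.
have aboveT w : w0 < w -> t < G w.
  move=> w0w; rewrite ltNge; apply/negP => Gw.
  by have := ub_le_sup supT.2 Gw; rewrite leNgt w0w.
have inv0 n : 0 < n.+1%:R^-1 :> R by rewrite invr_gt0.
(* Without atoms, [W < w0] and [W <= w0] have the same measure, and [pit <= t]
   lies between them. *)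
have lt_w0 : (mu [set x | (W x < w0)%R] <= t%:E)%E.
  pose B n := [set x | W x <= w0 - n.+1%:R^-1].
  have -> : [set x | W x < w0] = \bigcup_n B n.
    apply/seteqP; split => x.
      rewrite /= -subr_gt0 => /ltr_add_invr[n]; rewrite add0r => h.
      by exists n => //; rewrite /B/= lerBrDr -lerBrDl ltW.
    move=> [n _ /=] /le_lt_trans; apply; by rewrite ltrBlDr ltrDl.
  have mB n : measurable (B n) by exact: mle.
  have cv : mu \o B @ \oo --> mu (\bigcup_n B n).
    apply: nondecreasing_cvg_mu => //; first exact: bigcup_measurable.
    move=> n m nm; apply/subsetPset => x /= /le_trans; apply.
    by rewrite lerD2l lerN2 lef_pV2 ?posrE// ler_nat.
  rewrite -(cvg_lim _ cv)//; apply: lime_le.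
    by apply/cvg_ex; exists (mu (\bigcup_n B n)).
  by apply: nearW => n /=; rewrite -GE lee_fin; apply: belowT; rewrite ltrBlDr ltrDl.
have ge_w0 : (t%:E <= mu [set x | (W x <= w0)%R])%E.
  pose B n := [set x | W x <= w0 + n.+1%:R^-1].
  have -> : [set x | W x <= w0] = \bigcap_n B n.
    apply/seteqP; split => x /=.
      by move=> xw n _; rewrite /B/= (le_trans xw)// lerDl ltW.
    move=> Bx; rewrite leNgt -subr_gt0; apply/negP => /ltr_add_invr[n].
    by rewrite add0r ltrBrDl ltNge (Bx n).
  have mB n : measurable (B n) by exact: mle.
  have cv : mu \o B @ \oo --> mu (\bigcap_n B n).
    apply: nonincreasing_cvg_mu => //; first by rewrite -ge0_fin_numE// fin_num_measure.
      exact: bigcap_measurable.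
    move=> n m nm; apply/subsetPset => x /= /le_trans; apply.
    by rewrite lerD2l lef_pV2 ?posrE// ler_nat.
  rewrite -(cvg_lim _ cv)//; apply: lime_ge.
    by apply/cvg_ex; exists (mu (\bigcap_n B n)).
  by apply: nearW => n /=; rewrite -GE lee_fin ltW//; apply: aboveT; rewrite ltrDl.
apply/eqP; rewrite eq_le; apply/andP; split.
  apply: le_trans lt_w0; rewrite -le_cut; apply: le_measure; rewrite ?inE//.
  by move=> x Tx; exact: (ub_le_sup supT.2 Tx).
apply: (le_trans ge_w0); rewrite le_cut; apply: le_measure; rewrite ?inE//.
by move=> x; exact: belowT.
Qed.

Lemma pit_uniform_lt t : 0 <= t <= 1 -> mu [set x | pit x < t] = t%:E.
Proof.
move=> /andP[]; rewrite le_eqVlt => /predU1P[<- _|t0 t1].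
  rewrite (_ : [set _ | _] = set0) ?measure0//.
  by apply/seteqP; split => x //=; rewrite ltNge pit_ge0.
apply/eqP; rewrite eq_le; apply/andP; split.
  rewrite -pit_uniform ?t1 ?(ltW t0)//; apply: le_measure; rewrite ?inE//.
  by move=> x /ltW.
rewrite -(fineK (fin_num_measure mu _ (mpit_lt t))) lee_fin.
apply/ler_addgt0Pl => e e0; rewrite -lerBlDl.
have [te0|te0] := leP (t - e) 0; first by rewrite (le_trans te0)// fine_ge0.
rewrite -lee_fin fineK ?fin_num_measure// -pit_uniform; last first.
  by rewrite ltW//= (le_trans _ t1)// lerBlDr lerDl ltW.
apply: le_measure; rewrite ?inE// => x /= /le_lt_trans; apply.
by rewrite ltrBlDr ltrDl.
Qed.

End probability_integral_transform.

(* The code W compares points first by the sets A n and only then by the tree: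
   its coordinates are the complements of the A n, interleaved with the members
   of the tree cut down to these complements, each member recurring infinitely
   often through the exponent logn 2. *)
Lemma tree_uniform_chain d (X : measurableType d) (R : realType)
    (mu : probability X R) (TT : set (set X)) (C : set X -> set (set X))
    (A : nat -> set X) : is_tree_with mu TT C ->
  (forall n, measurable (A n)) -> (forall n, A n.+1 `<=` A n) ->
  mu (\bigcap_n A n) = 0%E ->
  exists V : X -> R, [/\ measurable_fun setT V, forall x, 0 <= V x <= 1,
    forall t, 0 <= t <= 1 -> mu [set x | V x <= t] = t%:E,
    forall t, 0 <= t <= 1 -> mu [set x | V x < t] = t%:E &
    forall n x, (A n x -> ((V x)%:E <= mu (A n))%E) /\
                (~ A n x -> (mu (A n) <= (V x)%:E)%E)].
Proof.
move=> treeC mA decA null.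
have [e [Te eT]] := tree_enumeration treeC.
have decAle n m : (n <= m)%N -> A m `<=` A n.
  by move=> /subnKC <-; elim: (m - n)%N => [|k IH]; rewrite ?addn0// addnS => x /decA/IH.
pose G n := if odd n then e (logn 2 n./2) `\` A n./2 else ~` A n./2.
have mG n : measurable (G n).
  have me k : measurable (e k) by exact: (tree_measurable treeC (Te k)).
  by rewrite /G; case: ifP => _; [exact: measurableD|exact: measurableC].
have [W [mW W01 Wlt]] := lexicographic_code R mG.
have W_chain m x y : A m x -> ~ A m y -> W x < W y.
  elim: m => [|m IH] Ax nAy.
    by apply: (Wlt x y 0%N) => //; rewrite /G/= => /(_ Ax).
  have [Amy|nAmy] := pselect (A m y); last by apply: IH => //; exact: decA.
  (* All coordinates before this one involve only [A 0], ..., [A m], which contain both points, so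
     these digits are all 0. The complement of [A m.+1] is then the first set to separate them. *)
  apply: (Wlt x y m.+1.*2) => [j jm||]; rewrite /G ?odd_double ?doubleK//=.
  have jm' : (j./2 <= m)%N by rewrite -ltnS ltn_half_double.
  have Ajx := decAle _ _ jm' _ (decA _ _ Ax); have Ajy := decAle _ _ jm' _ Amy.
  by case: ifP => _; split=> -[].
have W_inj x y n : W x = W y -> (G n x <-> G n y).
  move=> Wxy; elim/ltn_ind: n => n IH; split => Gn; apply: contrapT => nGn.
    by have := Wlt _ _ _ (fun j jn => iff_sym (IH j jn)) nGn Gn; rewrite Wxy ltxx.
  by have := Wlt _ _ _ IH nGn Gn; rewrite Wxy ltxx.
have mWeq w : measurable [set x | W x = w].
  by rewrite -[X in measurable X]setTI; exact: (mW measurableT _ (measurable_set1 w)).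
have W_atomless w : mu [set x | W x = w] = 0%E.
  (* A level set of [W] either lies in the null intersection of the [A n] or contains a point [x]
     outside some [A m]. In the second case it is shown to lie within the member of [x] at an
     arbitrarily deep level of the tree. *)
  have [[x [Wx [m nAx]]]|h] := pselect (exists x, W x = w /\ exists m, ~ A m x); last first.
    apply: (subset_measure0 (mWeq w) _ _ null); first exact: bigcapT_measurable.
    move=> x Wx m _; apply: contrapT => nAx; apply: h.
    by exists x; split => //; exists m.
  apply/eqP; rewrite eq_le measure_ge0 andbT; apply/lee_addgt0Pr => eps eps0.
  rewrite add0e; have [n small] := tree_level_small treeC eps0.
  have : setT x by []; rewrite -(tree_level_cover treeC n) => -[I LI Ix].
  have TI := tree_level_sub treeC LI.
  apply: le_trans (ltW (small n I (leqnn n) LI)).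
  apply: le_measure; rewrite ?inE//; first exact: (tree_measurable treeC TI).
  move=> y /= Wy; have [k ek] := eT _ TI.
  (* This index has 2-adic valuation [k] and is at least [m]. Coordinate [j.*2.+1] is therefore the
     member [e k] without [A j]; it contains [x], hence also every [y] with the same code. *)
  pose j := (2 ^ k * m.*2.+1)%N.
  have mj : (m <= j)%N.
    apply: (@leq_trans m.*2.+1); first by rewrite -addnn ltnW// ltnS leq_addr.
    by rewrite leq_pmull// expn_gt0.
  have jk : logn 2 j = k.
    rewrite lognM ?expn_gt0// pfactorK// logn_coprime ?addn0//.
    by rewrite coprime2n /= odd_double.
  have := @W_inj x y j.*2.+1 (etrans Wx (esym Wy)).
  rewrite /G /= odd_double /= uphalf_double jk ek => -[+ _].
  have nAjx : ~ A j x by move=> /(decAle _ _ mj).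
  by case=> //; split.
exists (pit mu W); split.
- exact: measurable_pit.
- by move=> x; rewrite pit_ge0 pit_le1.
- exact: pit_uniform.
- exact: pit_uniform_lt.
- move=> n x; split => Ax.
    apply: pit_le => // y; apply: contraPP => nAy; apply/negP; rewrite -ltNge.
    exact: W_chain nAy.
  by apply: pit_ge => // y Ay; apply/ltW; exact: W_chain Ax.
Qed.

(** * Extremal functions and the lower bound *)

Section extremal_function.
Context d (X : measurableType d) (R : realType) (mu : probability X R).
Context (V : X -> R) (mV : measurable_fun setT V) (V01 : forall x, 0 <= V x <= 1).
Context (Vle : forall t, 0 <= t <= 1 -> mu [set x | V x <= t] = t%:E).
Context (Vlt : forall t, 0 <= t <= 1 -> mu [set x | V x < t] = t%:E).
Context (p : R) (p1 : 1 < p) (f : R) (f0 : 0 < f) (f1 : f <= 1).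

Let V0 x : 0 <= V x. Proof. by case/andP: (V01 x). Qed.
Let p0 : 0 < p. Proof. exact: lt_trans p1. Qed.
Let pm1 : 0 < p - 1. Proof. by rewrite subr_gt0. Qed.
Let F := (p - 1) / p.
Let F0 : 0 < F. Proof. exact: divr_gt0. Qed.
Let tau := f `^ (p / (p - 1)).
Let tau0 : 0 < tau. Proof. exact: powR_gt0. Qed.
Let tau1 : tau <= 1.
Proof.
rewrite /tau -[leRHS](powRr0 f); apply: ger_powR; rewrite ?f0 ?f1//.
by rewrite divr_ge0// ltW.
Qed.

Lemma measurable_uniform_le t : measurable [set x | V x <= t].
Proof.
rewrite -[X in measurable X]setTI -preimage_itvNyc.
by apply: mV => //; exact: measurable_itv.
Qed.

Lemma measurable_uniform_lt t : measurable [set x | V x < t].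
Proof.
rewrite -[X in measurable X]setTI -preimage_itvNyo.
by apply: mV => //; exact: measurable_itv.
Qed.

Lemma measurable_uniform_oo t : measurable [set x | 0 < V x < t].
Proof.
rewrite (_ : [set _ | _] = ~` [set x | V x <= 0] `&` [set x | V x < t]).
  apply: measurableI; last exact: measurable_uniform_lt.
  exact/measurableC/measurable_uniform_le.
apply/seteqP; split => x /=.
  by move=> /andP[v0 ->]; split => //; apply/negP; rewrite -ltNge.
by move=> [/negP]; rewrite -ltNge => -> ->.
Qed.

(** Negative powers take their default value where [V] is 0, so inclusions between level sets can be
    verified only where [V] is positive; uniformity makes the remaining set null. *)
Lemma uniform_null_subset (A B : set X) : measurable A -> measurable B ->
  (forall x, A x -> 0 < V x -> B x) -> (mu A <= mu B)%E.
Proof.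
move=> mA mB AB; have mZ := measurable_uniform_le 0.
have Z0 : mu [set x | V x <= 0] = 0%E by rewrite Vle// lexx ler01.
apply: (@le_trans _ _ (mu (B `|` [set x | V x <= 0]))).
  apply: le_measure; rewrite ?inE//; first exact: measurableU.
  move=> x Ax; have [v0|] := ltP 0 (V x); last by right.
  by left; exact: AB.
by apply: (le_trans (measureU2 _ mB mZ)); rewrite [X in (_ + X)%E]Z0 adde0.
Qed.

Lemma uniform_tail a c : 0 <= a <= 1 -> 0 <= c ->
  mu ([set x | V x <= a] `&` [set x | 0 < V x < c]) = (Num.min a c)%:E.
Proof.
move=> a01 c0; have mI := measurableI _ _ (measurable_uniform_le a) (measurable_uniform_oo c).
have [ac|ca] := leP a c; apply/eqP; rewrite eq_le; apply/andP; split.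
- by rewrite -Vle//; apply: le_measure; rewrite ?inE//; exact: measurable_uniform_le.
- have [acE|] := eqVneq a c.
    have -> : a%:E = mu [set x | V x < c] by rewrite acE Vlt// -acE.
    apply: uniform_null_subset => //; first exact: measurable_uniform_lt.
    by move=> x /= va v0; rewrite v0 va acE ltW.
  move=> anc; have {}ac : a < c by rewrite lt_neqAle anc.
  rewrite -Vle//; apply: uniform_null_subset => //.
    exact: measurable_uniform_le.
  by move=> x /= va v0; rewrite v0 va (le_lt_trans va).
- have c01 : 0 <= c <= 1 by rewrite c0 (le_trans (ltW ca))//; case/andP: a01.
  rewrite -Vlt//; apply: le_measure; rewrite ?inE//; first exact: measurable_uniform_lt.
  by move=> x [_ /= /andP[]].
- have c01 : 0 <= c <= 1 by rewrite c0 (le_trans (ltW ca))//; case/andP: a01.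
  rewrite -Vlt//; apply: uniform_null_subset => //; first exact: measurable_uniform_lt.
  by move=> x /= vc v0; rewrite v0 vc (ltW (lt_trans vc ca)).
Qed.

(* At V x = 0 the negative power is the junk value 0; this set is null. *)
Definition extremal x := F * V x `^ (- p^-1) * \1_[set x | V x <= tau] x.

Lemma extremal_ge0 x : 0 <= extremal x.
Proof. by rewrite mulr_ge0// mulr_ge0 ?powR_ge0 ?(ltW F0). Qed.

Lemma measurable_extremal : measurable_fun setT extremal.
Proof.
apply: measurable_funM.
  apply: measurable_funM => //.
  by apply: (@measurableT_comp _ _ _ _ _ _ (@powR R ^~ (- p^-1))).
by apply: measurable_indic; exact: measurable_uniform_le.
Qed.

(** The value of V at which F V^(-1/p) equals [l]. It coincides with the largest tail that the weak
    norm F permits at height [l]. *)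
Let level l := F `^ p * l `^ (- p).

Let level_gt0 l : 0 < l -> 0 < level l.
Proof. by move=> l0; rewrite mulr_gt0 ?powR_gt0. Qed.

Let levelK l : 0 < l -> F * level l `^ (- p^-1) = l.
Proof.
move=> l0; rewrite powRM ?powR_ge0// -!powRrM mulrNN mulfV ?lt0r_neq0//.
rewrite mulrN mulfV ?lt0r_neq0// powRr1 ?ltW// powR_inv1 ?ltW// mulrA.
by rewrite mulfV ?mul1r ?lt0r_neq0.
Qed.

Let ip0 : - p^-1 < 0. Proof. by rewrite oppr_lt0 invr_gt0. Qed.

Let le_level l v : 0 < l -> 0 < v -> (l <= F * v `^ (- p^-1)) = (v <= level l).
Proof.
move=> l0 v0; rewrite -{1}(levelK l0) (ler_pM2l F0) lt0_ler_powR//.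
exact: level_gt0.
Qed.

Let lt_level l v : 0 < l -> 0 < v -> (l < F * v `^ (- p^-1)) = (v < level l).
Proof.
move=> l0 v0; rewrite -{1}(levelK l0) (ltr_pM2l F0) !ltNge lt0_ler_powR//.
exact: level_gt0.
Qed.

Lemma extremal_gt l x : 0 < l ->
  (l < extremal x) = (V x <= tau) && (0 < V x < level l).
Proof.
move=> l0; rewrite /extremal indicE; have [vt|vt] := leP (V x) tau; last first.
  by rewrite memNset ?mulr0 ?ltNge ?(ltW l0)//=; apply/negP; rewrite -ltNge.
rewrite mem_set// mulr1 /=.
have [v0|v0] := ltP 0 (V x); first by rewrite lt_level.
have -> : V x = 0 by apply/le_anti; rewrite v0 V0.
by rewrite powR0 ?mulr0 ?ltNge ?(ltW l0)// oppr_eq0 invr_eq0 lt0r_neq0.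
Qed.

Lemma extremal_tail s l : 0 <= s <= 1 -> 0 < l ->
  mu ([set x | V x <= s] `&` [set x | (l%:E < (extremal x)%:E)%E]) =
  (Num.min (Num.min s tau) (level l))%:E.
Proof.
move=> /andP[s0 s1] l0; rewrite -uniform_tail; last 2 first.
- by rewrite le_min s0 (ltW tau0)/= ge_min s1.
- by rewrite mulr_ge0 ?powR_ge0.
congr (mu _); apply/seteqP; split => x /=; rewrite lte_fin extremal_gt// le_min.
  by move=> [-> /andP[-> ->]].
by move=> [/andP[-> ->] ->].
Qed.

(** The tail over {V <= s} is the minimum of min(s, tau) and the weak-type tail, which is the
    integrand already evaluated. The truncation point tau is the one with tau^(1-1/p) = f, which
    gives [extremal] the integral [f]. *)
Lemma integral_extremal s : 0 <= s <= 1 ->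
  (\int[mu]_(x in [set x | (V x <= s)%R]) (extremal x)%:E =
   (Num.min (s `^ (1 - p^-1)) f)%:E)%E.
Proof.
move=> s01; have /andP[s0 s1] := s01.
have e0 : 0 < 1 - p^-1 by rewrite subr_gt0 invf_lt1.
have tauf : tau `^ (1 - p^-1) = f.
  rewrite /tau -powRrM -[RHS](powRr1 (ltW f0)); congr (_ `^ _).
  by field; rewrite !lt0r_neq0.
have -> : Num.min (s `^ (1 - p^-1)) f = (Num.min s tau) `^ (1 - p^-1).
  have [st|ts] := leP s tau.
    by rewrite min_l// -tauf ge0_ler_powR ?nnegrE// ltW.
  by rewrite min_r// -tauf ge0_ler_powR ?nnegrE// ?ltW.
rewrite -integral_min_powR//; last by rewrite le_min s0 ltW.
apply: layer_cake_eq => [|||l l0].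
- exact: measurable_uniform_le.
- exact/measurable_EFinP/measurable_extremal.
- by move=> x; rewrite lee_fin extremal_ge0.
- exact: extremal_tail.
Qed.

Lemma integral_extremal_setT : (\int[mu]_x (extremal x)%:E = f%:E)%E.
Proof.
have -> : [set: X] = [set x | V x <= 1].
  by apply/seteqP; split => x //= _; case/andP: (V01 x).
by rewrite integral_extremal ?lexx ?ler01// powR1 min_r.
Qed.

Let extremal_ge l x : 0 < l -> 0 < V x ->
  (l <= extremal x) = (V x <= tau) && (V x <= level l).
Proof.
move=> l0 v0; rewrite /extremal indicE; have [vt|vt] := leP (V x) tau.
  by rewrite mem_set// mulr1 le_level.
by rewrite memNset ?mulr0 ?leNgt ?l0//=; apply/negP; rewrite -ltNge.
Qed.

(** The product of [l] with the p-th root of [level l] is F for every [l], which bounds the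
    quasi-norm. It is attained at F tau^(-1/p), the least value on {0 < V <= tau}, where the
    superlevel set has the full measure tau. *)
Lemma weak_Lnorm_extremal : weak_Lnorm mu p extremal = F%:E.
Proof.
have mE l : measurable [set x | l <= extremal x].
  rewrite -[X in measurable X]setTI -preimage_itvcy.
  by apply: measurable_extremal => //; exact: measurable_itv.
have muE l : mu [set x | l <= extremal x] = (fine (mu [set x | l <= extremal x]))%:E.
  by rewrite fineK// fin_num_measure.
apply/eqP; rewrite eq_le; apply/andP; split.
  apply: ub_ereal_sup => _ [l /= l0 <-].
  have L0 := level_gt0 l0.
  rewrite muE poweR_EFin -EFinM lee_fin.
  have lE : l * level l `^ p^-1 = F.
    by rewrite -{1}(levelK l0) -mulrA mulr_powR// addNr powRr0 mulr1.
  rewrite -[leRHS]lE ler_pM2l// ge0_ler_powR ?nnegrE ?fine_ge0 ?invr_ge0 ?(ltW p0) ?(ltW L0)//.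
  rewrite -lee_fin -muE; have [L1|/ltW L1] := leP (level l) 1; last first.
    by apply: (le_trans (probability_le1 mu (mE l))); rewrite lee_fin.
  rewrite -Vle ?(ltW L0)//; apply: uniform_null_subset => //.
    exact: measurable_uniform_le.
  by move=> x /= + v0; rewrite extremal_ge// => /andP[].
pose l := F * tau `^ (- p^-1); have l0 : 0 < l by rewrite mulr_gt0 ?powR_gt0.
apply: (@le_trans _ _ (l%:E * mu [set x | (l <= extremal x)%R] `^ p^-1)%E); last first.
  by apply: ereal_sup_ubound; exists l.
rewrite muE poweR_EFin -EFinM lee_fin.
have lE : l * tau `^ p^-1 = F by rewrite -mulrA mulr_powR// addNr powRr0 mulr1.
rewrite -[leLHS]lE ler_pM2l// ge0_ler_powR ?nnegrE ?fine_ge0 ?invr_ge0 ?(ltW p0) ?(ltW tau0)//.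
rewrite -lee_fin -muE -Vle ?(ltW tau0)//; apply: uniform_null_subset => //.
  exact: measurable_uniform_le.
move=> x /= vt v0; rewrite extremal_ge// vt -le_level// /l ler_pM2l//.
by rewrite lt0_ler_powR.
Qed.

(* The average of the decreasing rearrangement of extremal over [0, V x]. *)
Definition profile x := Num.min (V x `^ (- p^-1)) (f * V x `^ (-1)).

Lemma measurable_profile : measurable_fun setT profile.
Proof.
have mVc c : measurable_fun setT (fun x => V x `^ c).
  by apply: (@measurableT_comp _ _ _ _ _ _ (@powR R ^~ c)).
by apply: (measurable_minr (mVc _)); apply: measurable_funM.
Qed.

Lemma profile_ge0 x : 0 <= profile x.
Proof. by rewrite le_min powR_ge0 mulr_ge0 ?powR_ge0// ltW. Qed.

Lemma profile_gt u x : 0 < u ->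
  (u < profile x) = (0 < V x < Num.min (f / u) (u `^ (- p))).
Proof.
move=> u0; have [v0|v0] := ltP 0 (V x); last first.
  have -> : V x = 0 by apply/le_anti; rewrite v0 V0.
  rewrite /profile (_ : V x = 0); last by apply/le_anti; rewrite v0 V0.
  rewrite lt_min powR0 ?oppr_eq0 ?invr_eq0 ?lt0r_neq0//.
  by rewrite ltNge (ltW u0).
rewrite !lt_min powR_inv1 ?ltW// ltr_pdivlMr// mulrC -ltr_pdivlMr//= andbC.
have uK : (u `^ (- p)) `^ (- p^-1) = u.
  by rewrite -powRrM mulrNN mulfV ?lt0r_neq0// powRr1// ltW.
by congr (_ && _); rewrite -{1}uK ltNge lt0_ler_powR ?powR_gt0// -ltNge.
Qed.

(** On {V <= k} the tails of [profile] are equal to the bounds found for the maximal function, which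
    reproduces the integral of the upper bound. *)
Lemma integral_profile (q k : R) : 1 < q -> q < p -> 0 <= k <= 1 ->
  (\int[mu]_(x in [set x | (V x <= k)%R]) (profile x `^ q)%:E =
   \int[@lebesgue_measure R]_(l in `]0%R, +oo[)
     (Num.min k (Num.min (f * l `^ (- q^-1)) (l `^ (- (p / q)))))%:E)%E.
Proof.
move=> q1 qp k01; have q0 : 0 < q by exact: lt_trans q1.
apply: layer_cake_eq => [|||l l0].
- exact: measurable_uniform_le.
- apply/measurable_EFinP.
  apply: (@measurableT_comp _ _ _ _ _ _ (@powR R ^~ q)); last exact: measurable_profile.
  exact: measurable_powR.
- by move=> x; rewrite lee_fin powR_ge0.
have u0 : 0 < l `^ q^-1 by exact: powR_gt0.
have -> : f * l `^ (- q^-1) = f / l `^ q^-1 by rewrite powRN.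
have -> : l `^ (- (p / q)) = (l `^ q^-1) `^ (- p) by rewrite -powRrM mulrN mulrC.
rewrite -uniform_tail//; last by rewrite le_min powR_ge0 divr_ge0// ltW.
have gtE x : (l < profile x `^ q) = (l `^ q^-1 < profile x).
  by rewrite !ltNge powR_le_root ?profile_ge0 ?(ltW l0).
by congr (mu (_ `&` _)); apply/seteqP; split => x /=; rewrite lte_fin gtE profile_gt.
Qed.

End extremal_function.

Lemma exprn_lt_exists (R : realType) (r e : R) : 0 < r < 1 -> 0 < e ->
  exists n, r ^+ n < e.
Proof.
move=> /andP[r0 r1] e0; have /cvgr0_norm_lt : r ^+ n @[n --> \oo] --> (0 : R).
  by apply: cvg_expr; rewrite ger0_norm// ltW.
move=> /(_ e e0)[n _ h]; exists n.
by apply: le_lt_trans (h n (leqnn n)); exact: ler_norm.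
Qed.

(** * Averages over the members of the chain and the lower bound *)

Section lower_bound.
Context d (X : measurableType d) (R : realType) (mu : probability X R).
Context (TT : set (set X)) (C : set X -> set (set X)).
Context (treeC : is_tree_with mu TT C).
Context (r : R) (r01 : 0 < r < 1).
Context (FF : nat -> set (set X)).
Context (FF0 : FF 0%N = [set setT]) (FT : forall n, FF n `<=` TT).
Local Notation A n := (\bigcup_(I in FF n) I).
Context (decA : forall n, A n.+1 `<=` A n).
Context (muFF : forall n m I, FF n I -> (mu (I `&` A (n + m)%N) = (r ^+ m)%:E * mu I)%E).

Let r0 : 0 < r. Proof. by case/andP: r01. Qed.
Let r1 : r < 1. Proof. by case/andP: r01. Qed.

Lemma measurable_chain n : measurable (A n).
Proof.
apply: measurable_bigcup_family => [|I /FT]; last exact: (tree_measurable treeC).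
exact: (sub_countable (subset_card_le (@FT n)) (tree_countable treeC)).
Qed.

Lemma measure_chain n : mu (A n) = (r ^+ n)%:E.
Proof.
have := @muFF 0%N n setT; rewrite setTI add0n probability_setT mule1.
by apply; rewrite FF0.
Qed.

Lemma chain_null : mu (\bigcap_n A n) = 0%E.
Proof.
have mI : measurable (\bigcap_n A n).
  by apply: bigcapT_measurable => n; exact: measurable_chain.
apply/eqP; rewrite eq_le measure_ge0 andbT; apply/lee_addgt0Pr => e e0.
have [n ne] := exprn_lt_exists r01 e0.
rewrite add0e; apply: (@le_trans _ _ (mu (A n))).
  by apply: le_measure; rewrite ?inE//; [exact: measurable_chain|move=> x; exact].
by rewrite measure_chain lee_fin ltW.
Qed.

Context (V : X -> R) (mV : measurable_fun setT V) (V01 : forall x, 0 <= V x <= 1).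
Context (Vle : forall t, 0 <= t <= 1 -> mu [set x | V x <= t] = t%:E).
Context (Vlt : forall t, 0 <= t <= 1 -> mu [set x | V x < t] = t%:E).
Context (VA : forall n x, (A n x -> ((V x)%:E <= mu (A n))%E) /\
                          (~ A n x -> (mu (A n) <= (V x)%:E)%E)).

(** Inside [I] only the sets [A (n + m)] have known measure, and on them V is at most r^(n+m). With
    [m] least such that r^(n+m) < t, either m = 0 or r^(n+m-1) >= t, so this rounding costs at most
    one factor [r]. *)
Lemma chain_uniform_tail n I t : FF n I -> 0 < t ->
  ((r / r ^+ n * Num.min (r ^+ n) t)%:E * mu I <= mu (I `&` [set x | (0 < V x < t)%R]))%E.
Proof.
move=> FI t0; have TI := FT FI; have mI := tree_measurable treeC TI.
have rn0 k : 0 < r ^+ k by rewrite exprn_gt0.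
have ex : exists m, r ^+ (n + m) < t.
  have [m mt] := exprn_lt_exists r01 t0; exists m; apply: le_lt_trans mt.
  by rewrite exprD ler_piMl ?exprn_ile1// ltW.
pose m := ex_minn ex; have mt : r ^+ (n + m) < t by rewrite /m; case: ex_minnP.
apply: (@le_trans _ _ (mu (I `&` A (n + m)%N))); last first.
  apply: (uniform_null_subset mV Vle).
  - by apply: measurableI => //; exact: measurable_chain.
  - by apply: measurableI => //; exact: (measurable_uniform_oo mV).
  move=> x [Ix Ax] v0; split => //=; rewrite v0/=; apply: le_lt_trans mt.
  by rewrite -lee_fin -measure_chain; exact: (VA _ _).1.
rewrite muFF// lee_wpmul2r// lee_fin.
rewrite mulrAC ler_pdivrMr// -exprD addnC.
rewrite /m; case: ex_minnP => -[|k] kt kmin.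
  rewrite addn0 (le_trans (_ : _ <= r * r ^+ n))//.
    by rewrite ler_pM2l// ge_min lexx.
  by rewrite ler_piMl// ltW.
rewrite addnS exprS ler_pM2l// ge_min; apply/orP; right.
by rewrite leNgt; apply/negP => /kmin; rewrite ltnn.
Qed.

Context (p : R) (p1 : 1 < p) (f : R) (f0 : 0 < f) (f1 : f <= 1).
Local Notation phi := (extremal V p f).

(** The left side is [r] times [mu I] times the average of [extremal] over {V <= r^n}. Both
    integrals are written by layer cake; at each height the superlevel set is, where V > 0, of the
    form V < t or cut at tau, so the previous bound compares the integrands. *)
Lemma chain_integral_extremal n I : FF n I ->
  ((r / r ^+ n * Num.min ((r ^+ n) `^ (1 - p^-1)) f)%:E * mu I <=
   \int[mu]_(x in I) (phi x)%:E)%E.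
Proof.
move=> FI; have TI := FT FI; have mI := tree_measurable treeC TI.
have rn0 : 0 < r ^+ n by rewrite exprn_gt0.
have rn01 : 0 <= r ^+ n <= 1 by rewrite ltW//= exprn_ile1// ltW.
have mphi : measurable_fun setT (EFin \o phi).
  by apply/measurable_EFinP; exact: measurable_extremal.
have phi0 x : (0 <= (EFin \o phi) x)%E by rewrite lee_fin; exact: extremal_ge0.
have mVn : measurable [set x | V x <= r ^+ n] by exact: measurable_uniform_le.
have muI : mu I = (fine (mu I))%:E by rewrite fineK// fin_num_measure.
have c0 : 0 <= r / r ^+ n * fine (mu I).
  by rewrite mulr_ge0 ?fine_ge0// divr_ge0// ltW.
have -> : ((r / r ^+ n * Num.min ((r ^+ n) `^ (1 - p^-1)) f)%:E * mu I =
    (r / r ^+ n * fine (mu I))%:E *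
    \int[mu]_(x in [set x | (V x <= r ^+ n)%R]) (phi x)%:E)%E.
  by rewrite (integral_extremal mV V01 Vle Vlt)// muI -!EFinM mulrAC.
rewrite !(layer_cake mu _ mphi phi0)// -ge0_integralZl//; last first.
  by apply: measurable_funTS; exact: (measurable_tail mu mVn mphi).
apply: ge0_le_integral => //.
- by move=> l _; rewrite mule_ge0.
- apply: measurable_funTS; apply: measurable_funeM; exact: (measurable_tail mu mVn mphi).
- by apply: measurable_funTS; exact: (measurable_tail mu mI mphi).
move=> l; rewrite /= in_itv/= andbT => l0.
rewrite (extremal_tail mV V01 Vle Vlt)// -minA.
set t := Num.min (_ `^ (p / _)) _.
have t0 : 0 < t.
  rewrite lt_min powR_gt0// mulr_gt0 ?powR_gt0// divr_gt0 ?subr_gt0//.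
  exact: lt_trans p1.
have -> : ((r / r ^+ n * fine (mu I))%:E * (Num.min (r ^+ n) t)%:E =
    (r / r ^+ n * Num.min (r ^+ n) t)%:E * mu I)%E.
  by rewrite muI -!EFinM mulrAC.
apply: (le_trans (chain_uniform_tail FI t0)).
apply: le_measure; rewrite ?inE//.
- by apply: measurableI => //; exact: (measurable_uniform_oo mV).
- by apply: measurableI => //; exact: measurable_gt.
move=> x [Ix /=]; rewrite lt_min => /and3P[v0 vt vl]; split => //.
by rewrite lte_fin extremal_gt// (ltW vt) v0.
Qed.

(** The operator is tested on the member of [FF n] that contains [x], for the last [n] with [x] in
    [A n]. Its average already carries one factor [r]. Since [x] has left [A n.+1], r^(n+1) <= V x,
    and replacing r^n by V x in either term of the minimum costs at most another. *)
Lemma dyadic_maximal_profile x : ~ (\bigcap_n A n) x ->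
  ((r * r * profile V p f x)%:E <= dyadic_maximal mu TT phi x)%E.
Proof.
move=> nAx.
have ex : exists m, `[< ~ A m x >].
  apply: contrapT => h; apply: nAx => m _; apply: contrapT => nAm; apply: h.
  by exists m; apply/asboolP.
case: (ex_minnP ex) => -[|n] /asboolP nAn min_n.
  by exfalso; apply: nAn; exists setT => //; rewrite FF0.
have [I FI Ix] : A n x.
  apply: contrapT => nA; have := min_n n; rewrite ltnn => /(_ _)/negP; apply => //.
  exact/asboolP.
apply: (dyadic_maximal_ge treeC (extremal_ge0 _ p1 _) (FT FI) Ix).
apply: le_trans (chain_integral_extremal FI).
have rn0 : 0 < r ^+ n by rewrite exprn_gt0.
rewrite lee_wpmul2r// lee_fin -!mulrA ler_pM2l//.
have Vx : r ^+ n.+1 <= V x by rewrite -lee_fin -measure_chain; exact: (VA _ _).2.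
have v0 : 0 < V x by apply: lt_le_trans Vx; rewrite exprn_gt0.
have ip1 : p^-1 <= 1 by rewrite invf_le1 ?(ltW p1)// (lt_trans _ p1).
rewrite [leRHS]mulrC ler_pdivlMr// mulrAC le_min -exprS; apply/andP; split.
- rewrite -mulr_powR// (powRr1 (ltW rn0)) exprS mulrAC mulrC ler_pM2l//.
  apply: (@le_trans _ _ (r * (r ^+ n.+1) `^ (- p^-1))).
    rewrite ler_pM2l//; apply: (@le_trans _ _ (V x `^ (- p^-1))).
      by rewrite ge_min lexx.
    by apply: le0_ger_powR => //; rewrite ?exprn_gt0// oppr_le0 invr_ge0 ltW// (lt_trans _ p1).
  rewrite exprS powRM ?(ltW r0) ?(ltW rn0)// mulrA ler_piMl ?powR_ge0//.
  rewrite -{1}(powRr1 (ltW r0)) mulr_powR// -[leRHS](powRr0 r).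
  by apply: ger_powR; rewrite ?r0 ?(ltW r1)// subr_ge0.
- apply: (@le_trans _ _ (V x * profile V p f x)).
    by rewrite ler_wpM2r// profile_ge0.
  rewrite mulrC -ler_pdivlMr// ge_min; apply/orP; right.
  by rewrite powR_inv1// ltW.
Qed.

End lower_bound.

Lemma Delta_lower_bound d (X : measurableType d) (R : realType)
    (mu : probability X R) (TT : set (set X)) (p q f k r : R) :
  is_tree mu TT -> 1 < q -> q < p -> 0 < f -> f <= 1 -> 0 <= k <= 1 ->
  0 < r < 1 ->
  (((r * r) `^ q)%:E * \int[@lebesgue_measure R]_(l in `]0%R, +oo[)
     (Num.min k (Num.min (f * l `^ (- q^-1)) (l `^ (- (p / q)))))%:E <=
   Delta mu TT p q f ((p - 1) / p) k)%E.
Proof.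
move=> [C treeC] q1 qp f0 f1 k01 r01.
have p1 : 1 < p by exact: lt_trans qp.
have /andP[r0 r1] := r01.
have [|FF [FF0 FT tF decF muFF]] := tree_hierarchy treeC (r := r).
  by rewrite !ltW.
have mA := measurable_chain treeC FT.
have null := chain_null treeC r01 FF0 FT muFF.
have [V [mV V01 Vle Vlt VA]] := tree_uniform_chain treeC mA decF null.
pose phi := extremal V p f.
have mphi : measurable_fun setT phi by exact: measurable_extremal.
have mK : measurable [set x | V x <= k] by exact: measurable_uniform_le.
have mMq : measurable_fun setT (fun x => dyadic_maximal mu TT phi x `^ q)%E.
  by apply: (measurableT_comp (measurable_poweR _)); exact: (measurable_dyadic_maximal treeC).
have mpq : measurable_fun setT (fun x => (profile V p f x `^ q)%:E).
  apply/measurable_EFinP.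
  apply: (@measurableT_comp _ _ _ _ _ _ (@powR R ^~ q)); first exact: measurable_powR.
  exact: measurable_profile.
rewrite -(integral_profile mV V01 Vle Vlt p1 f0 q1 qp k01).
rewrite -ge0_integralZl//; last 3 first.
- exact: measurable_funTS.
- by move=> x _; rewrite lee_fin powR_ge0.
- by rewrite lee_fin powR_ge0.
apply: (@le_trans _ _ (\int[mu]_(x in [set x | (V x <= k)%R])
    (dyadic_maximal mu TT phi x `^ q))%E); last first.
  apply: ereal_sup_ubound; exists phi, [set x | V x <= k]; split => //.
  - by split => // x; exact: extremal_ge0.
  - exact: (integral_extremal_setT mV V01 Vle Vlt).
  - exact: weak_Lnorm_extremal.
  - by split => //; exact: Vle.
apply: ae_ge0_le_integral => //.
- by move=> x _; rewrite -EFinM lee_fin mulr_ge0 ?powR_ge0.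
- by apply: measurable_funTS; exact: measurable_funeM.
- by move=> x _; exact: poweR_ge0.
- exact: measurable_funTS.
(* The pointwise bound needs a last index [n] with [x] in [A n]; such an index exists off the
   intersection of the chain, which is null. *)
exists (\bigcap_n (\bigcup_(I in FF n) I)); split => //.
  exact: bigcapT_measurable.
move=> x /=; apply: contra_notP => nAx _.
rewrite -EFinM -powRM ?mulr_ge0 ?profile_ge0 ?(ltW r0)// -poweR_EFin.
apply: gt0_ler_poweR; rewrite ?in_itv/= ?leey ?andbT ?lee_fin.
- by rewrite ltW// (lt_trans _ q1).
- by rewrite !mulr_ge0 ?profile_ge0 ?(ltW r0).
- by apply: (dyadic_maximal_ge0 treeC) => y; exact: extremal_ge0.
exact: (dyadic_maximal_profile treeC r01 FF0 FT muFF mV V01 Vle Vlt VA).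
Qed.

Theorem theorem4p1 (R : realType) (d : measure_display) (X : measurableType d)
    (mu : probability X R) (TT : set (set X))
    (hmu : nonatomic mu) (hTT : is_tree mu TT)
    (p q : R) (hq : 1 < q) (hqp : q < p)
    (f k : R) (hf0 : 0 < f) (hf1 : f <= 1) (hk0 : 0 <= k) (hk1 : k <= 1) :
  (k <= f `^ (p / (p - 1)) ->
     Delta mu TT p q f ((p - 1) / p) k =
       (p / (p - q) * k `^ (1 - q / p))%:E) /\
  (f `^ (p / (p - 1)) <= k ->
     Delta mu TT p q f ((p - 1) / p) k =
       (q * (p - 1) / ((p - q) * (q - 1)) * f `^ ((p - q) / (p - 1))
        - 1 / (q - 1) * (k `^ (1 - q) * f `^ q))%:E).
Proof.
(* A single identity serves both ranges of [k], which differ only in the evaluation of the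
   integral. *)
suff DE : Delta mu TT p q f ((p - 1) / p) k =
    (\int[@lebesgue_measure R]_(l in `]0%R, +oo[)
     (Num.min k (Num.min (f * l `^ (- q^-1)) (l `^ (- (p / q)))))%:E)%E.
  by split => ?; rewrite DE; [exact: integral_tail_small|exact: integral_tail_large].
apply/eqP; rewrite eq_le; apply/andP; split.
  have [C treeC] := hTT.
  apply: ub_ereal_sup => _ [phi [K [[mphi phi0] phif phiF [mK Kk] ->]]].
  apply: (integral_dyadic_maximal_le _ mphi phi0 phiF treeC) => //.
  exact: lt_trans hqp.
apply/lee_mul01Pr => [|c c01].
  apply: integral_ge0 => l; rewrite /= in_itv/= andbT => l0.
  by rewrite lee_fin !le_min hk0 powR_ge0 mulr_ge0 ?powR_ge0// ltW.
have /andP[c0 c1] := c01.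
have q0 : 0 < q by exact: lt_trans hq.
pose r := c `^ (q + q)^-1.
have r01 : 0 < r < 1.
  have : r < 1 `^ (q + q)^-1.
    by rewrite gt0_ltr_powR ?nnegrE ?(ltW c0)// invr_gt0 addr_gt0.
  by rewrite powR1 => ->; rewrite andbT powR_gt0.
have <- : (r * r) `^ q = c.
  rewrite mulr_powR// -powRrM -[RHS](powRr1 (ltW c0)); congr (_ `^ _).
  by field; rewrite lt0r_neq0 ?addr_gt0.
by apply: Delta_lower_bound; rewrite ?hk0.
Qed.
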